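(* The polynomials $u_1,u_2,u_3,u_4,u_5$ and $L_1$ generate the algebra of $\mathrm{AVect}(\mathbb{R}^{2n+1})\cap\mathrm{CVect}(\mathbb{R}^{2n+1})$-invariant polynomials in $\mathcal{S}(\mathbb{R}^{2n+1})$.
   Context: Let $n\ge 1$ and let $(p_1,\dots,p_n,q^1,\dots,q^n,t)$ be the canonical coordinates of $\mathbb{R}^{2n+1}$, endowed with the contact form $\alpha=\frac12\big(\sum_{k}(p_k\,dq^k-q^k\,dp_k)-dt\big)$. Put $\Omega=\alpha\wedge(d\alpha)^n$ (a constant multiple of the standard volume form) and $\mathrm{I}=\frac1{n+1}$. $\mathrm{CVect}(\mathbb{R}^{2n+1})$ is the Lie algebra of contact vector fields, i.e. vector fields $X$ with $L_X\alpha=f_X\alpha$ for some smooth function $f_X$. $\mathrm{AVect}(\mathbb{R}^{2n+1})$ is the Lie algebra of affine vector fields (coefficients are polynomials of degree $\le 1$ in the coordinates). For $M=\mathbb{R}^{2n+1}$, $k,m,\ell\in\mathbb{N}$ and $\nu\in\mathbb{R}$, let $\mathcal{S}^{km}_{\ell;\nu}(M)=\Gamma(S^kTM\otimes S^mTM\otimes S^\ell T^*M\otimes\mathbb{F}_\nu M)$, where $S^k$ is the $k$-th symmetric power and $\mathbb{F}_\nu M$ is the line bundle of $\nu$-densities; sections of $\mathbb{F}_\nu M$ are written $f|\Omega|^\nu$ with $f\in C^\infty(M)$. An element is regarded as a polynomial $Q(\xi,\eta,Y)$, homogeneous of degrees $k,m,\ell$ in the fiber variables $\xi,\eta$ (covectors)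 and $Y$ (vector), with coefficients in the $\nu$-densities. Set $\mathcal{S}(M)=\bigoplus_{k,m,\ell\in\mathbb{N},\,\nu\in\mathbb{R}}\mathcal{S}^{km}_{\ell;\nu}(M)$, an algebra under multiplication of polynomials (density weights add up). Identifying $\nu$-densities with functions via $|\Omega|^\nu$, a vector field $X=X^i\partial_i$ acts on $Q\in\mathcal{S}^{km}_{\ell;\nu}(M)$ by $$L_XQ=X(Q)-\partial_jX^i\,\eta_i\,\partial_{\eta_j}Q-\partial_jX^i\,\xi_i\,\partial_{\xi_j}Q+\partial_jX^i\,Y^j\,\partial_{Y^i}Q+\nu\,\partial_iX^i\,Q$$ (summation over repeated indices; $X(Q)$ differentiates the coefficients only). Invariance under a Lie algebra of vector fields means $L_XQ=0$ for all its members. Write $\xi_{p_k},\xi_{q^k},\xi_t$ for the components of $\xi$ (similarly for $\eta$), and $\langle\mathcal{E}_s,\xi_s\rangle=\sum_k(p_k\xi_{p_k}+q^k\xi_{q^k})$ (similarly for $\eta$). The polynomials in the statement are: - $u_1(\xi,\eta,Y)=\langle Y,\xi\rangle\in\mathcal{S}^{10}_{1;0}$; - $u_2(\xi,\eta,Y)=\langle Y,\eta\rangle\in\mathcal{S}^{01}_{1;0}$; - $u_3(\xi,\eta,Y)=\alpha(Y)|\Omega|^{-\mathrm{I}}\in\mathcal{S}^{00}_{1;-\mathrm{I}}$; - $u_4(\xi,\eta,Y)=-2\xi_t|\Omega|^{\mathrm{I}}\in\mathcal{S}^{10}_{0;\mathrm{I}}$; - $u_5(\xi,\eta,Y)=-2\eta_t|\Omega|^{\mathrm{I}}\in\mathcal{S}^{01}_{0;\mathrm{I}}$;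 - $L_1(\xi,\eta,Y)=\Big(\sum_k(\xi_{p_k}\eta_{q^k}-\xi_{q^k}\eta_{p_k})+\eta_t\langle\mathcal{E}_s,\xi_s\rangle-\xi_t\langle\mathcal{E}_s,\eta_s\rangle\Big)|\Omega|^{\mathrm{I}}\in\mathcal{S}^{11}_{0;\mathrm{I}}$. *)

(* Defs.v *)
From HB Require Import structures.
From mathcomp Require Import all_boot all_order all_algebra finmap.
From mathcomp Require Import all_classical all_reals all_analysis.
From mathcomp.multinomials Require monalg mpoly.
(* The notations of these two files clash with those of MathComp-Analysis. *)
Import (canonicals, coercions) monalg mpoly.

Set Implicit Arguments.
Unset Strict Implicit.
Unset Printing Implicit Defensive.

Import numFieldNormedType.Exports.
Import GRing.Theory.

Local Open Scope classical_set_scope.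
Local Open Scope ring_scope.

(* [galg A G] is the group algebra A[G] of an additive group G, i.e. the direct
   sum of copies of A indexed by G, with weights adding up under multiplication.
   [monalg] only has the product for monoids in which 1 is the only unit. *)
Section GroupAlgebra.
Variables (A : comNzRingType) (G : zmodType).

Definition galg : Type := monalg.malg G A.
HB.instance Definition _ := GRing.Zmodule.on galg.

Definition gcoef (g : G) (x : galg) : A := monalg.mcoeff g x.
Definition gsupp (x : galg) : {fset G} := monalg.msupp x.
(* [gmono] and [gmul] are locked to keep failing conversion tests cheap. *)
Fact galg_key : unit. Proof. by []. Qed.
Definition gmono : G -> A -> galg := locked_with galg_key (fun g a => monalg.mkmalgU g a).
Canonical gmono_unlockable := [unlockable fun gmono].

Implicit Types (x y z : galg) (g h : G) (a b : A).

Lemma galgP x y : (forall g, gcoef g x = gcoef g y) <-> x = y.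
Proof. exact: monalg.malgP. Qed.

Fact gmonoB g : {morph gmono g : a b / a - b}.
Proof. by move=> a b; rewrite [gmono]unlock; exact: monalg.monalgUB. Qed.
HB.instance Definition _ g := GRing.isZmodMorphism.Build A galg (gmono g) (@gmonoB g).

Fact gcoefB g : {morph gcoef g : x y / x - y}.
Proof. exact: monalg.mcoeffB. Qed.
HB.instance Definition _ g := GRing.isZmodMorphism.Build galg A (gcoef g) (@gcoefB g).

Lemma gcoef_mono g h a : gcoef h (gmono g a) = a *+ (g == h).
Proof. by rewrite [gmono]unlock; exact: monalg.mcoeffU. Qed.

Lemma gcoef_out g x : g \notin gsupp x -> gcoef g x = 0.
Proof. exact: monalg.mcoeff_outdom. Qed.

Lemma galgE x : x = \sum_(g <- gsupp x) gmono g (gcoef g x).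
Proof. by rewrite [gmono]unlock; exact: monalg.monalgE. Qed.

Definition gone : galg := gmono 0 1.
Definition gmul : galg -> galg -> galg := locked_with galg_key (fun x y =>
  \sum_(g <- gsupp x) \sum_(h <- gsupp y) gmono (g + h) (gcoef g x * gcoef h y)).
Canonical gmul_unlockable := [unlockable fun gmul].

Lemma gmulw (d1 d2 : {fset G}) x y :
  (gsupp x `<=` d1)%fset -> (gsupp y `<=` d2)%fset ->
  gmul x y = \sum_(g <- d1) \sum_(h <- d2) gmono (g + h) (gcoef g x * gcoef h y).
Proof.
move=> le1 le2; rewrite [gmul]unlock (big_fset_incl _ le1) /=.
  apply: eq_bigr => g _; apply: big_fset_incl => // h _ /gcoef_out ->.
  by rewrite mulr0 raddf0.
move=> g _ /gcoef_out xg; rewrite big1 // => h _.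
by rewrite xg mul0r raddf0.
Qed.

Fact gmulC : commutative gmul.
Proof.
move=> x y; rewrite [gmul]unlock exchange_big; apply: eq_bigr => g _.
by apply: eq_bigr => h _; rewrite addrC mulrC.
Qed.

Fact gmulDl : left_distributive gmul +%R.
Proof.
move=> x y z; pose d := (gsupp x `|` gsupp y `|` gsupp (x + y)%R)%fset.
have lx : (gsupp x `<=` d)%fset.
  by rewrite /d -fsetUA; exact: fsubsetUl.
have ly : (gsupp y `<=` d)%fset.
  by rewrite /d (fsetUC (gsupp x)) -fsetUA; exact: fsubsetUl.
have lxy : (gsupp (x + y)%R `<=` d)%fset by exact: fsubsetUr.
have lz := fsubset_refl (gsupp z).
rewrite (gmulw lx lz) (gmulw ly lz) (gmulw lxy lz) -big_split /=.
apply: eq_bigr => g _; rewrite -big_split /=; apply: eq_bigr => h _.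
by rewrite raddfD mulrDl raddfD.
Qed.

Fact gmulDr : right_distributive gmul +%R.
Proof. by move=> x y z; rewrite gmulC gmulDl !(gmulC _ x). Qed.

Fact gmul0r : left_zero 0 gmul.
Proof. by move=> x; apply: (@addrI _ (gmul 0 x)); rewrite -gmulDl !addr0. Qed.

Fact gmulr0 : right_zero 0 gmul.
Proof. by move=> x; rewrite gmulC gmul0r. Qed.

Lemma gmul_sumr (I : Type) (s : seq I) (F : I -> galg) x :
  gmul x (\sum_(i <- s) F i) = \sum_(i <- s) gmul x (F i).
Proof. exact: (big_morph (gmul x) (gmulDr x) (gmulr0 x)). Qed.

Lemma gmul_suml (I : Type) (s : seq I) (F : I -> galg) x :
  gmul (\sum_(i <- s) F i) x = \sum_(i <- s) gmul (F i) x.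
Proof. by rewrite gmulC gmul_sumr; apply: eq_bigr => i _; rewrite gmulC. Qed.

Lemma gmul_mono g h a b : gmul (gmono g a) (gmono h b) = gmono (g + h) (a * b).
Proof.
have le k c : (gsupp (gmono k c) `<=` [fset k])%fset 
  by rewrite [gmono]unlock; exact: monalg.msuppU_le.
by rewrite (gmulw (le g a) (le h b)) !big_seq_fset1 !gcoef_mono !eqxx.
Qed.

Fact gmulA : associative gmul.
Proof.
move=> x y z; rewrite (galgE x) !gmul_suml; apply: eq_bigr => g _.
rewrite (galgE y) gmul_suml !gmul_sumr gmul_suml; apply: eq_bigr => h _.
rewrite (galgE z) !gmul_sumr; apply: eq_bigr => k _.
by rewrite !gmul_mono addrA mulrA.
Qed.

Fact gmul1r : left_id gone gmul.
Proof.
move=> x; rewrite {1}(galgE x) gmul_sumr [RHS]galgE; apply: eq_bigr => g _.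
by rewrite gmul_mono add0r mul1r.
Qed.

Fact gone_neq0 : gone != 0.
Proof.
apply/eqP => /galgP/(_ 0) /eqP.
by rewrite gcoef_mono eqxx raddf0 oner_eq0.
Qed.

HB.instance Definition _ := GRing.Zmodule_isComNzRing.Build galg
  gmulA gmulC gmul1r gmulDl gone_neq0.

End GroupAlgebra.

Section SmoothFunctions.
Variables (R : realType) (N : nat).
Implicit Types (f g : 'rV[R]_N -> R) (i : 'I_N) (k : nat).

Definition pd i f : 'rV[R]_N -> R := 'D_('e_i) f.

Fixpoint Ck k f : Prop :=
  if k is k'.+1 then
    continuous f /\ forall i, (forall x, derivable f x 'e_i) /\ Ck k' (pd i f)
  else continuous f.

Definition smooth : {pred 'rV[R]_N -> R} := fun f => `[< forall k, Ck k f >].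

Lemma smoothP f : reflect (forall k, Ck k f) (f \in smooth).
Proof. exact: asboolP. Qed.

Lemma Ck_cont k f : Ck k f -> continuous f.
Proof. by case: k => //= k []. Qed.

Lemma CkS k f : Ck k.+1 f -> Ck k f.
Proof.
elim: k f => [|k IH] f; first by case.
move=> [cf df]; split => // i; have [dfi /IH] := df i; by split.
Qed.

Lemma CkD k f g : Ck k f -> Ck k g -> Ck k (f + g).
Proof.
elim: k f g => [|k IH] f g; first by move=> cf cg x; exact: (cvgD (cf x) (cg x)).
move=> [cf df] [cg dg]; split; first by move=> x; exact: (cvgD (cf x) (cg x)).
move=> i; have [dfi Cf] := df i; have [dgi Cg] := dg i.
split; first by move=> x; exact: derivableD.
have -> : pd i (f + g) = pd i f + pd i g by apply/funext => x; exact: deriveD.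
exact: IH.
Qed.

Lemma CkN k f : Ck k f -> Ck k (- f).
Proof.
elim: k f => [|k IH] f; first by move=> cf x; exact: (cvgN (cf x)).
move=> [cf df]; split; first by move=> x; exact: (cvgN (cf x)).
move=> i; have [dfi Cf] := df i.
split; first by move=> x; exact: derivableN.
have -> : pd i (- f) = - pd i f by apply/funext => x; exact: deriveN.
exact: IH.
Qed.

Lemma CkM k f g : Ck k f -> Ck k g -> Ck k (f * g).
Proof.
elim: k f g => [|k IH] f g; first by move=> cf cg x; exact: (cvgM (cf x) (cg x)).
move=> Cf' Cg'; have [cf df] := Cf'; have [cg dg] := Cg'.
split; first by move=> x; exact: (cvgM (cf x) (cg x)).
move=> i; have [dfi Cf] := df i; have [dgi Cg] := dg i.
split; first by move=> x; exact: derivableM.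
have -> : pd i (f * g) = f * pd i g + g * pd i f.
  by apply/funext => x; exact: deriveM.
by apply: CkD; apply: IH => //; apply: CkS.
Qed.

Lemma pd_cst i (c : R) : pd i (cst c) = cst 0.
Proof. by apply/funext => x; rewrite /pd derive_cst. Qed.

Lemma Ck_cst k (c : R) : Ck k (cst c).
Proof.
elim: k c => [|k IH] c; first exact: cst_continuous.
split; first exact: cst_continuous.
by move=> i; split; [move=> x; exact: derivable_cst|rewrite pd_cst].
Qed.

Fact smooth_subring : subring_closed smooth.
Proof.
split => [|f g /smoothP Cf /smoothP Cg|f g /smoothP Cf /smoothP Cg].
- by apply/smoothP => k; exact: Ck_cst.
- by apply/smoothP => k; apply: CkD => //; exact: CkN.
- by apply/smoothP => k; exact: CkM.
Qed.
HB.instance Definition _ :=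
  GRing.isSubringClosed.Build ('rV[R]_N -> R) smooth smooth_subring.

Record Cinf := MkCinf { Cinf_val :> 'rV[R]_N -> R; _ : Cinf_val \in smooth }.
HB.instance Definition _ := [isSub for Cinf_val].
HB.instance Definition _ := [Choice of Cinf by <:].
HB.instance Definition _ := [SubChoice_isSubComNzRing of Cinf by <:].

Lemma CinfP (f : Cinf) : Cinf_val f \in smooth.
Proof. by case: f. Qed.

Fact pd_smooth i f : f \in smooth -> pd i f \in smooth.
Proof. by move=> /smoothP Cf; apply/smoothP => k; have [_ /(_ i)[]] := Cf k.+1. Qed.

Definition dC i (f : Cinf) : Cinf := MkCinf (pd_smooth i (CinfP f)).

Fact dC_is_zmod_morphism i : zmod_morphism (dC i).
Proof.
move=> f g; apply: val_inj; apply/funext => x /=.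
have df (h : Cinf) : derivable h x 'e_i.
  by have /smoothP/(_ 1%N)[_ /(_ i)[]] := CinfP h.
by rewrite /pd deriveB.
Qed.
HB.instance Definition _ i :=
  GRing.isZmodMorphism.Build Cinf Cinf (dC i) (@dC_is_zmod_morphism i).

Fact cst_smooth (c : R) : cst c \in smooth.
Proof. by apply/smoothP => k; exact: Ck_cst. Qed.

Definition cstC (c : R) : Cinf := MkCinf (cst_smooth c).

Fact cstC_is_monoid_morphism : monoid_morphism cstC.
Proof. by split => [|a b]; apply: val_inj; apply/funext. Qed.
Fact cstC_is_zmod_morphism : zmod_morphism cstC.
Proof. by move=> a b; apply: val_inj; apply/funext. Qed.
HB.instance Definition _ := GRing.isZmodMorphism.Build R Cinf cstC cstC_is_zmod_morphism.
HB.instance Definition _ :=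
  GRing.isMonoidMorphism.Build R Cinf cstC cstC_is_monoid_morphism.

Fact coord_smooth i : (fun x : 'rV[R]_N => x 0 i) \in smooth.
Proof.
have cc : continuous (fun x : 'rV[R]_N => x 0 i) by exact: coord_continuous.
have @f : {linear 'rV[R]_N -> R}.
  by exists (fun x : 'rV[R]_N => x 0 i); do 2![eexists]; do ?[constructor];
     rewrite ?mxE// => ? *; rewrite ?mxE//; move=> ?; rewrite !mxE.
apply/smoothP => -[|k] //; split=> // j; split.
  by move=> x; exact/diff_derivable/differentiable_coord.
have -> : pd j (fun x : 'rV[R]_N => x 0 i) = cst (('e_j : 'rV[R]_N) 0 i).
  apply/funext => x; rewrite /pd deriveE; last exact: differentiable_coord.
  by rewrite (_ : (fun _ => _) = f) // diff_lin.
exact: Ck_cst.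
Qed.

Definition coord i : Cinf := MkCinf (coord_smooth i).

End SmoothFunctions.

(* Polynomials in xi (first N variables), eta (next N), Y (last N) over C^oo(R^N),
   i.e. the sum over k, m, l of Gamma(S^k T (x) S^m T (x) S^l T^* ). *)
Notation fpoly R N := (mpoly.mpoly (N + N + N) (Cinf R N)).

Section Symbols.
Variables (R : realType) (N : nat).
Local Notation F := (Cinf R N).

Local Notation fpoly := (fpoly R N).

Definition xi_idx (i : 'I_N) : 'I_(N + N + N) := lshift N (lshift N i).
Definition eta_idx (i : 'I_N) : 'I_(N + N + N) := lshift N (rshift N i).
Definition Y_idx (i : 'I_N) : 'I_(N + N + N) := rshift (N + N) i.

Definition fvar (j : 'I_(N + N + N)) : fpoly := mpoly.mpolyX F (mpoly.mnm1 j).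
Definition dfvar (j : 'I_(N + N + N)) (Q : fpoly) : fpoly := mpoly.mderiv j Q.
Definition dcoef (i : 'I_N) (Q : fpoly) : fpoly := mpoly.map_mpoly (dC i) Q.

Definition xi i := fvar (xi_idx i).
Definition eta i := fvar (eta_idx i).
Definition Y i := fvar (Y_idx i).

Definition vfield := 'I_N -> F.

Definition lie (nu : R) (X : vfield) (Q : fpoly) : fpoly :=
  \sum_i X i *: dcoef i Q
  - \sum_i \sum_j dC j (X i) *: (eta i * dfvar (eta_idx j) Q)
  - \sum_i \sum_j dC j (X i) *: (xi i * dfvar (xi_idx j) Q)
  + \sum_i \sum_j dC j (X i) *: (Y j * dfvar (Y_idx i) Q)
  + (cstC N nu * \sum_i dC i (X i)) *: Q.

(* [gmono nu Q : symb] is the polynomial Q with coefficients in the nu-densities,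
   Q |Omega|^nu; Omega being a constant multiple of the standard volume, densities
   are identified with functions via |Omega|^nu and nu only enters through [lie]. *)
Definition symb : Type := galg fpoly R.
HB.instance Definition _ := GRing.ComNzRing.on symb.

(* The scalars act through constant functions, of weight 0. *)
Definition symbC (c : R) : symb := gmono 0 (cstC N c *: 1 : fpoly).

Fact symbC1 : symbC 1 = 1.
Proof. by rewrite /symbC rmorph1 scale1r. Qed.
Fact symbCD : {morph symbC : a b / a + b}.
Proof. by move=> a b; rewrite /symbC rmorphD scalerDl raddfD. Qed.
Fact symbCM : {morph symbC : a b / a * b}.
Proof.
move=> a b; rewrite /symbC [RHS]gmul_mono addr0 rmorphM /=.
by rewrite -scalerAl mul1r scalerA.
Qed.

Definition symb_scale (c : R) (x : symb) : symb := symbC c * x.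
Fact symb_scaleA a b x : symb_scale a (symb_scale b x) = symb_scale (a * b) x.
Proof. by rewrite /symb_scale mulrA (symbCM a b). Qed.
Fact symb_scale1 : left_id 1 symb_scale.
Proof. by move=> x; rewrite /symb_scale symbC1 mul1r. Qed.
Fact symb_scaleDr : right_distributive symb_scale +%R.
Proof. by move=> a x y; exact: mulrDr. Qed.
Fact symb_scaleDl x : {morph symb_scale^~ x : a b / a + b}.
Proof. by move=> a b; rewrite /symb_scale symbCD mulrDl. Qed.
HB.instance Definition _ := GRing.Zmodule_isLmodule.Build R symb
  symb_scaleA symb_scale1 symb_scaleDr symb_scaleDl.
Fact symb_scaleAl (a : R) (x y : symb) : a *: (x * y) = (a *: x) * y.
Proof. exact: mulrA. Qed.
HB.instance Definition _ := GRing.Lmodule_isLalgebra.Build R symb symb_scaleAl.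

Definition symb_lie (X : vfield) (S : symb) : symb :=
  \sum_(nu <- gsupp S) gmono nu (lie nu X (gcoef nu S)).

Definition affine (X : vfield) : Prop :=
  exists (A : 'M[R]_N) (b : 'rV[R]_N), forall i x, X i x = (x *m A + b) 0 i.

End Symbols.

Section Contact.
Variables (R : realType) (n : nat).
Local Notation N := (n + n + 1)%N.
Implicit Types (X : vfield R N) (k : 'I_n).

(* Indices of the coordinates (p_1, .., p_n, q^1, .., q^n, t). *)
Definition ip k : 'I_N := lshift 1 (lshift n k).
Definition iq k : 'I_N := lshift 1 (rshift n k).
Definition it : 'I_N := rshift (n + n) ord0.

Local Notation x_ := (coord R).
Local Notation xi := (@xi R N).
Local Notation eta := (@eta R N).
Local Notation Y := (@Y R N).

(* The polynomial alpha(Y), for alpha = 1/2 (sum_k (p_k dq^k - q^k dp_k) - dt). *)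
Definition alpha : fpoly R N :=
  cstC N 2^-1 *: (\sum_k (x_ (ip k) *: Y (iq k) - x_ (iq k) *: Y (ip k)) - Y it).

(* On polynomials of degree (0, 0, 1) in (xi, eta, Y), [lie 0] is the Lie
   derivative of 1-forms. *)
Definition contact X : Prop := exists f : Cinf R N, lie 0 X alpha = f *: alpha.

Definition AC_invariant (S : symb R N) : Prop :=
  forall X, affine X -> contact X -> symb_lie X S = 0.

(* <E_s, zeta_s> for zeta = xi, eta *)
Definition euler (zeta : 'I_N -> fpoly R N) : fpoly R N :=
  \sum_k (x_ (ip k) *: zeta (ip k) + x_ (iq k) *: zeta (iq k)).

(* The weight 1 / (n + 1). *)
Definition wI : R := n.+1%:R^-1.

Definition u1 : symb R N := gmono 0 (\sum_i Y i * xi i).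
Definition u2 : symb R N := gmono 0 (\sum_i Y i * eta i).
Definition u3 : symb R N := gmono (- wI) alpha.
Definition u4 : symb R N := gmono wI (- 2 * xi it).
Definition u5 : symb R N := gmono wI (- 2 * eta it).
Definition L1 : symb R N := gmono wI
  (\sum_k (xi (ip k) * eta (iq k) - xi (iq k) * eta (ip k))
   + eta it * euler xi - xi it * euler eta).

End Contact.

(* The (unital) subalgebra generated by B. *)
Definition gen_subalg (K : pzRingType) (A : lalgType K) (B : set A) : set A :=
  smallest [set C : set A | GRing.subalg_closed [pred x | x \in C]] B.

(* Main.v *)
(* An invariant is determined by its value at the origin: the contact fields lifting
   the translations express each derivative of a coefficient through coefficients of
   monomials of higher degree in (xi_s, eta_s, Y_t), so descending induction on that
   degree shows that an invariant vanishing at the origin is 0. There the dilation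
   lets each monomial occur for one density weight only, hence summing the values over
   all weights is injective on invariants, and the linear symplectic fields make the
   sum an sp(2n)-invariant polynomial in xi_s, eta_s, Y_s, with parameters xi_t, eta_t,
   Y_t.

   The first fundamental theorem for these three vectors is proved at the generic
   point. Invariance under sp(2n) integrates to invariance under transvections, which
   bring a generic triple with pairings (a, b, c) to (e, a f, b f - (c / a) e), for a
   hyperbolic pair (e, f), up to taking the closure of the orbit. So a ^ m P is a
   polynomial in the pairings and the parameters for some m; as these remain
   algebraically independent modulo a, the factor a ^ m can be divided out. *)

Require Import Defs.
From HB Require Import structures.
From mathcomp Require Import all_boot all_order all_algebra finmap.
From mathcomp Require Import all_classical all_reals all_analysis.
From mathcomp Require Import ring lra.
From mathcomp.multinomials Require monalg mpoly.
Import -(notations) mpoly.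

Set Implicit Arguments.
Unset Strict Implicit.
Unset Printing Implicit Defensive.

Import GRing.Theory numFieldNormedType.Exports.
Local Open Scope ring_scope.

(** All weights are treated at once because summing over them and evaluating at the origin is a ring
    morphism. It then suffices to exhibit invariants whose values at the origin generate the
    sp(2n)-invariants: the polynomial that expresses the value of S, applied to these lifts, is an
    invariant with the same value as S, hence S itself. Passing to the generic point turns
    identities of polynomials into identities in a field of fractions, where one can divide by
    pairings. Such a field carries no exponential and no limit, so both are replaced by polynomials
    in one variable t: the orbit of a one-parameter group of transvections is a segment, along which
    the derivative of P vanishes, and a polynomial in t that is constant for t != 0 keeps its value
    at 0. The normal form of a triple is built on a fixed pair (e, f) with constant entries, so
    that, besides the parameters, only a, b, c and the inverse of a enter. This inverse is the sole
    source of denominators. *)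

Local Notation var i := (mpolyX _ (mnm1 i)).

(** * Evaluation of polynomials *)

Section MPolyEvaluation.
Variable n : nat.

(** Induction along sums and products rather than monomials, which suits statements about ring
    morphisms and derivations. *)
Lemma mpoly_ring_ind (R : nzRingType) (T : mpoly n R -> Prop) :
  (forall c, T (mpolyC n c)) -> (forall i, T (var i)) ->
  (forall p q, T p -> T q -> T (p + q)) ->
  (forall p q, T p -> T q -> T (p * q)) -> forall p, T p.
Proof.
move=> TC TX TD TM p; elim/mpolyind: p => [|c m p _ _ Tp].
  by rewrite -(mpolyC0 n R).
apply: (TD) => //; rewrite -mul_mpolyC; apply: (TM) => //; rewrite mpolyXE_id.
apply: big_ind => [|p1 p2|i _]; [exact: (TC 1)|exact: TM|].
elim: (m i) => [|k IH]; first exact: (TC 1).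
by rewrite exprS; apply: (TM).
Qed.

Lemma eq_mmap (R S : nzRingType) (f f' : R -> S) (h h' : 'I_n -> S) p :
  f =1 f' -> h =1 h' -> mmap f h p = mmap f' h' p.
Proof.
move=> ff' hh'; rewrite /mmap; apply: eq_bigr => m _.
by rewrite ff' (mmap1_eq _ hh').
Qed.

Lemma rmorph_mmap (R S S' : nzRingType) (g : {rmorphism S -> S'})
    (f : R -> S) (h : 'I_n -> S) p :
  g (mmap f h p) = mmap (g \o f) (g \o h) p.
Proof.
rewrite /mmap raddf_sum; apply: eq_bigr => m _ /=.
rewrite rmorphM /mmap1 rmorph_prod; congr (_ * _).
by apply: eq_bigr => i _; rewrite rmorphXn.
Qed.

Lemma mmap_var (R S : nzRingType) (f : {rmorphism R -> S}) (h : 'I_n -> S) i :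
  mmap f h (var i) = h i.
Proof. by rewrite mmapX mmap1U. Qed.

Lemma mmap_id (R : comNzRingType) (p : mpoly n R) :
  mmap (mpolyC n (R := R)) (fun i => var i) p = p.
Proof.
rewrite [RHS]mpolyE /mmap; apply: eq_bigr => m _.
by rewrite mul_mpolyC mmap1_id.
Qed.

Lemma mderiv_var (R : nzRingType) i j : mderiv i (var j : mpoly n R) = (j == i)%:R.
Proof.
rewrite mderivX mnm1E; case: eqP => [->|_]; last by rewrite scale0r.
by rewrite scale1r -mpolyX0; congr mpolyX; apply/mnmP => k; rewrite mnmBE subnn mnm0E.
Qed.

(** The chain rule for a derivation that kills the coefficients. It serves to differentiate a
    polynomial along a segment, with [D] the derivative of univariate polynomials. *)
Lemma mmap_chain (R : nzRingType) (S : comNzRingType) (f : {rmorphism R -> S})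
    (h : 'I_n -> S) (D : {additive S -> S}) p :
  (forall a b, D (a * b) = D a * b + a * D b) -> (forall c, D (f c) = 0) ->
  D (mmap f h p) = \sum_i D (h i) * mmap f h (mderiv i p).
Proof.
move=> DM Df; elim/mpoly_ring_ind: p => [c|j|p q IHp IHq|p q IHp IHq].
- by rewrite mmapC Df big1 // => i _; rewrite mderivC mmap0 mulr0.
- rewrite mmap_var (bigD1 j) //= mderiv_var eqxx rmorph1 mulr1 big1 ?addr0 //.
  by move=> i ij; rewrite mderiv_var eq_sym (negPf ij) mmap0 mulr0.
- rewrite !raddfD IHp IHq -big_split; apply: eq_bigr => i _ /=.
  by rewrite mderivD mmapD mulrDr.
- rewrite rmorphM DM IHp IHq mulr_suml mulr_sumr -big_split.
  by apply: eq_bigr => i _ /=; rewrite mderivM mmapD !rmorphM /=; ring.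
Qed.

(** Division by a variable: the remainder is the restriction to the hyperplane where that variable
    is 0, so [p] is divisible once this restriction vanishes. *)
Lemma mpoly_split_var (R : comNzRingType) (i : 'I_n) (p : mpoly n R) :
  exists q, p = mmap (mpolyC n (R := R))
    (fun j => if j == i then 0 else var j) p + var i * q.
Proof.
elim/mpoly_ring_ind: p => [c|j|p q [p' Ep] [q' Eq]|p q [p' Ep] [q' Eq]].
- by exists 0; rewrite mmapC mulr0 addr0.
- rewrite mmap_var; case: eqP => [->|_]; first by exists 1; rewrite mulr1 add0r.
  by exists 0; rewrite mulr0 addr0.
- by exists (p' + q'); rewrite mmapD {1}Ep {1}Eq; ring.
- set g := (fun j => _) in Ep Eq *.
  exists (p' * mmap (mpolyC n (R := R)) g q + p * q').
  by rewrite rmorphM /= {1}Ep {1}Eq {3}Ep; ring.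
Qed.

End MPolyEvaluation.

Lemma deriv0_const (K : fieldType) (p : {poly K}) : [pchar K] =i pred0 ->
  deriv p = 0 -> p = (p`_0)%:P.
Proof.
move=> /pcharf0P K0 /polyP dp; apply/polyP => -[|i]; rewrite coefC //=.
have /eqP := dp i; rewrite coef_deriv coef0 -mulr_natr mulf_eq0 K0 orbF.
by move/eqP.
Qed.

(** The algebraic substitute for passing to the closure of an orbit, valid over any field of
    characteristic 0. *)
Lemma const_except0 (K : fieldType) (p : {poly K}) c : [pchar K] =i pred0 ->
  (forall t, t != 0 -> p.[t] = c) -> p.[0] = c.
Proof.
move=> /[dup] K0 /pcharf0P nz pc; suff /eqP : p - c%:P = 0.
  by rewrite subr_eq0 => /eqP ->; rewrite hornerC.
(* The elements 1, 2, ... are nonzero and distinct in characteristic 0; as many of them as the size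
   of the polynomial are roots, which is one too many unless it is 0. *)
pose rs : seq K := [seq i.+1%:R | i <- iota 0 (size (p - c%:P))].
have rs_uniq : uniq rs.
  rewrite map_inj_uniq ?iota_uniq // => i j /eqP.
  wlog le_ij : i j / (i <= j)%N.
    by move=> th; case/orP: (leq_total i j) => ? ?; [|apply/esym];
       apply: th; rewrite // eq_sym.
  rewrite eq_sym -subr_eq0 -natrB // nz subSS subn_eq0 => le_ji.
  by apply/eqP; rewrite eqn_leq le_ij.
apply: roots_geq_poly_eq0 rs_uniq _; last by rewrite size_map size_iota.
apply/allP => _ /mapP[i _ ->]; apply/rootP; rewrite !hornerE pc ?subrr //.
by rewrite nz.
Qed.

(** * Symplectic linear algebra *)

Section Symplectic.
Variables (n : nat).

Definition sympJ (K : pzRingType) : 'M[K]_(n + n) := block_mx 0 1%:M (- 1%:M) 0.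

Lemma sympJ_sqr (K : pzRingType) : sympJ K *m sympJ K = - 1%:M.
Proof.
rewrite mulmx_block !mul0mx !mulmx0 !mulmx1 !mul1mx !add0r !addr0.
by rewrite scalar_mx_block opp_block_mx !oppr0.
Qed.

Lemma tr_sympJ (K : pzRingType) : (sympJ K)^T = - sympJ K.
Proof.
by rewrite tr_block_mx opp_block_mx !trmx0 linearN /= !trmx1 !oppr0 opprK.
Qed.

Definition symp (K : pzRingType) (v w : 'rV[K]_(n + n)) : K :=
  (v *m sympJ K *m w^T) 0 0.

Section CommutativeRing.
Variable K : comNzRingType.
Implicit Types (v w : 'rV[K]_(n + n)) (s : K).

Lemma sympDl v v' w : symp (v + v') w = symp v w + symp v' w.
Proof. by rewrite /symp !mulmxDl mxE. Qed.
Lemma sympDr v w w' : symp v (w + w') = symp v w + symp v w'.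
Proof. by rewrite /symp linearD mulmxDr mxE. Qed.
Lemma sympZl s v w : symp (s *: v) w = s * symp v w.
Proof. by rewrite /symp -!scalemxAl mxE. Qed.
Lemma sympZr s v w : symp v (s *: w) = s * symp v w.
Proof. by rewrite /symp linearZ -scalemxAr mxE. Qed.
Lemma sympC v w : symp v w = - symp w v.
Proof.
have trE (A : 'M[K]_1) : A 0 0 = A^T 0 0 by rewrite mxE.
by rewrite /symp trE !trmx_mul trmxK tr_sympJ mulNmx mulmxN mulmxA mxE.
Qed.
Lemma sympE v w : symp v w =
  \sum_k (v 0 (lshift n k) * w 0 (rshift n k) - v 0 (rshift n k) * w 0 (lshift n k)).
Proof.
rewrite /symp -[v]hsubmxK -[w]hsubmxK tr_row_mx mul_row_block mul_row_col.
rewrite !mulmx0 mulmx1 mulmxN mulmx1 add0r addr0 mulNmx addrC mxE mxE mxE.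
rewrite [X in _ - X]mxE -sumrB; apply: eq_bigr => k _.
by rewrite !row_mxEl !row_mxEr ?mxE.
Qed.
Lemma symp_self v : symp v v = 0.
Proof. by rewrite sympE big1 // => k _; rewrite mulrC subrr. Qed.
Lemma sympNl v w : symp (- v) w = - symp v w.
Proof. by rewrite -scaleN1r sympZl mulN1r. Qed.
Lemma sympNr v w : symp v (- w) = - symp v w.
Proof. by rewrite -scaleN1r sympZr mulN1r. Qed.

Lemma symp_el v (k : 'I_n) : symp v (delta_mx 0 (lshift n k)) = - v 0 (rshift n k).
Proof.
rewrite /symp trmx_delta -colE mxE -{1}[v]hsubmxK /sympJ mul_row_block.
by rewrite !mulmx0 mulmxN mulmx1 add0r row_mxEl !mxE.
Qed.

Lemma symp_ef (k : 'I_n) :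
  symp (delta_mx 0 (lshift n k)) (delta_mx 0 (rshift n k)) = 1 :> K.
Proof. by rewrite /symp -rowE trmx_delta -colE mxE mxE block_mxEur mxE eqxx. Qed.

End CommutativeRing.

Variable K : fieldType.
Implicit Types (u v w x y z : 'rV[K]_(n + n)) (s t : K).

Lemma symp_nondeg u : u != 0 -> exists x, symp u x != 0.
Proof.
move=> u0; have uJ0 : u *m sympJ K != 0.
  apply: contra u0 => /eqP uJ; rewrite -oppr_eq0 -[u]mulmx1 -mulmxN -sympJ_sqr.
  by rewrite mulmxA uJ mul0mx.
have /rV0Pn[i ui] := uJ0; exists (delta_mx 0 i).
by rewrite /symp trmx_delta -colE mxE.
Qed.

Definition symp_lin :=
  (@sympDl K, @sympDr K, @sympNl K, @sympNr K, @sympZl K, @sympZr K).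

Definition transv u s v := v + (s * symp v u) *: u.

Lemma transv_fix u s v : symp v u = 0 -> transv u s v = v.
Proof. by move=> vu; rewrite /transv vu mulr0 scale0r addr0. Qed.

(** Two vectors that are not orthogonal are joined by a single transvection, along their
    difference. *)
Lemma transv_move x y : symp x y != 0 -> transv (y - x) (symp x y)^-1 x = y.
Proof.
move=> xy; rewrite /transv !symp_lin symp_self subr0 mulVf // scale1r.
by rewrite addrC subrK.
Qed.

Lemma transv_lin u s a b v w :
  transv u s (a *: v + b *: w) = a *: transv u s v + b *: transv u s w.
Proof.
rewrite /transv !symp_lin !scalerDr !scalerA [RHS]addrACA; congr (_ + _).
by rewrite -scalerDl; congr (_ *: _); ring.
Qed.

Lemma transvD u s v w : transv u s (v + w) = transv u s v + transv u s w.
Proof. by have := transv_lin u s 1 1 v w; rewrite !scale1r. Qed.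

Lemma transv_symp u s v w : symp (transv u s v) (transv u s w) = symp v w.
Proof. by rewrite /transv !symp_lin symp_self (sympC u); ring. Qed.

(* The orbit of a triple under transvections has a standard representative in its
   closure: for [symp v1 v2 != 0], the component of v3 orthogonal to v1 and v2 can
   be contracted to 0, because all nonzero vectors orthogonal to v1 and v2 are
   conjugate under the stabilizer of (v1, v2). *)
Section Slice.
Variables (k : 'I_n) (F : 'rV[K]_(n + n) -> 'rV[K]_(n + n) -> 'rV[K]_(n + n) -> K).
Let e : 'rV[K]_(n + n) := delta_mx 0 (lshift n k).
Let f : 'rV[K]_(n + n) := delta_mx 0 (rshift n k).

Hypothesis K0 : [pchar K] =i pred0.
Hypothesis F_transv : forall u s v1 v2 v3,
  F (transv u s v1) (transv u s v2) (transv u s v3) = F v1 v2 v3.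
Hypothesis F_poly : forall v1 v2 v3 w,
  exists p : {poly K}, forall t, F v1 v2 (v3 + t *: w) = p.[t].

Lemma slice_span v1 v2 v3 : symp v1 v2 != 0 ->
  F v1 v2 v3 = F v1 v2 ((- (symp v2 v3 / symp v1 v2)) *: v1
                        + (symp v1 v3 / symp v1 v2) *: v2).
Proof.
set a := symp v1 v2; move=> a0; set v' := _ + _.
have [->|u0] := eqVneq v3 v' => //.
pose u := v3 - v'; have {u0} u0 : u != 0 by rewrite subr_eq0.
have v21 : symp v2 v1 = - a by rewrite sympC.
(* The projection onto the orthogonal of [v1] and [v2], along their span. The vector [v'] is the
   complementary component of [v3]. *)
pose proj x := x + (symp v2 x / a) *: v1 - (symp v1 x / a) *: v2.
have projE x : proj x = x + (symp v2 x / a) *: v1 - (symp v1 x / a) *: v2 by [].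
clearbody proj; have proj1 x : symp v1 (proj x) = 0.
  by rewrite projE !symp_lin symp_self -/a mulr0 addr0 divfK // subrr.
have proj2 x : symp v2 (proj x) = 0.
  by rewrite projE !symp_lin symp_self v21 mulr0 subr0 mulrN divfK // subrr.
have uE : u = proj v3.
  by rewrite /u /v' projE opprD scaleNr opprK addrA.
have v3E : v3 = v' + u by rewrite addrC subrK.
clearbody u; have [x ux] := symp_nondeg u0; pose w := proj x.
have wproj : w = proj x by [].
clearbody w; have symp_uw : symp u w = symp u x.
  have u1 : symp u v1 = 0 by rewrite sympC uE proj1 oppr0.
  have u2 : symp u v2 = 0 by rewrite sympC uE proj2 oppr0.
  by rewrite wproj projE !symp_lin u1 u2 !mulr0 addr0 subr0.
have v'_proj y : symp v' (proj y) = 0.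
  by rewrite /v' !symp_lin proj1 proj2 !mulr0 addr0.
have [p Fp] := F_poly v1 v2 v' w.
(* For t != 0 the transvection along [t *: w - u] carries [u] to [t *: w], and it fixes [v1], [v2]
   and [v'], which are orthogonal to its direction. *)
have pE : forall t, t != 0 -> p.[t] = F v1 v2 v3.
  move=> t t0; rewrite -Fp.
  have utw : symp u (t *: w) != 0 by rewrite symp_lin symp_uw mulf_neq0.
  have wE : t *: w - u = proj (t *: x - v3).
    rewrite uE wproj !projE !symp_lin; apply/rowP => i; rewrite !mxE; ring.
  rewrite -(F_transv (t *: w - u) (symp u (t *: w))^-1 v1 v2 v3).
  rewrite (@transv_fix _ _ v1) ?wE // (@transv_fix _ _ v2) ?wE //; congr F.
  by rewrite -wE v3E transvD transv_move // transv_fix // wE.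
by rewrite -(const_except0 K0 pE) -Fp scale0r addr0.
Qed.

Lemma slice v1 v2 v3 : symp v1 e != 0 -> symp v1 v2 != 0 ->
  F v1 v2 v3 = F e (symp v1 v2 *: f)
    (symp v1 v3 *: f - (symp v2 v3 / symp v1 v2) *: e).
Proof.
move=> v1e a0; rewrite slice_span //; set a := symp v1 v2 in a0 *.
set b := symp v1 v3 / a; set c := symp v2 v3 / a.
pose u := e - v1; pose s := (symp v1 e)^-1.
rewrite -(F_transv u s) transv_lin transv_move //.
have : symp e (transv u s v2) = a.
  by rewrite -{1}(transv_move v1e) transv_symp.
move: (transv u s v2) => {v1e u s} v2' av2'.
(* Moving [v2'] to [a *: f] requires their pairing to be nonzero. If it is 0, the transvection along
   [e] with parameter 1, which fixes [e], adds [- a *: e] to [v2'] and makes the pairing - a ^ 2. *)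
have [l l0] : exists l, symp (transv e l v2') (a *: f) != 0.
  have [v2f|] := eqVneq (symp v2' (a *: f)) 0.
    exists 1; rewrite /transv sympDl v2f add0r !symp_lin symp_ef (sympC v2').
    by rewrite av2' mulr1 mul1r mulNr oppr_eq0 mulf_neq0.
  by exists 0; rewrite /transv mul0r scale0r addr0.
rewrite -(F_transv e l) transv_lin transv_fix ?symp_self //.
have : symp e (transv e l v2') = a.
  by rewrite -av2' -(transv_symp e l e v2') (@transv_fix e l e) ?symp_self.
move: l0; move: (transv e l v2') => w wf ew.
(* This last move fixes [e], because [e] has the same pairing a with [w] and with [a *: f]. *)
rewrite -(F_transv (a *: f - w) (symp w (a *: f))^-1) transv_lin transv_move //.
rewrite transv_fix; last by rewrite !symp_lin symp_ef ew mulr1 subrr.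
by rewrite scalerA divfK // scaleNr addrC.
Qed.

End Slice.

End Symplectic.

(** * Polynomial invariants of the symplectic Lie algebra *)

Lemma sum_phase (V : nmodType) (n : nat) (F : 'I_(n + n + 1) -> V) :
  \sum_i F i = \sum_i F (lshift 1 i) + F (it n).
Proof. by rewrite big_split_ord big_ord1. Qed.

Lemma sum_fvar (V : nmodType) (N : nat) (F : 'I_(N + N + N) -> V) :
  \sum_j F j = \sum_i F (xi_idx i) + \sum_i F (eta_idx i) + \sum_i F (Y_idx i).
Proof. by rewrite !big_split_ord. Qed.

Lemma fvarP (N : nat) (T : 'I_(N + N + N) -> Prop) :
  (forall i, T (xi_idx i)) -> (forall i, T (eta_idx i)) ->
  (forall i, T (Y_idx i)) -> forall j, T j.
Proof.
move=> Tx Te TY j; case: (split_ordP j) => [k|i] ->; last exact: TY.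
by case: (split_ordP k) => i ->; [exact: Tx|exact: Te].
Qed.

Definition fpoint (T : Type) (N : nat) (x y z : 'rV[T]_N) : 'I_(N + N + N) -> T :=
  row_mx (row_mx x y) z 0.

Section Fpoint.
Variables (T : Type) (N : nat) (x y z : 'rV[T]_N).
Lemma fpoint_xi i : fpoint x y z (xi_idx i) = x 0 i.
Proof. by rewrite /fpoint !row_mxEl. Qed.
Lemma fpoint_eta i : fpoint x y z (eta_idx i) = y 0 i.
Proof. by rewrite /fpoint row_mxEl row_mxEr. Qed.
Lemma fpoint_Y i : fpoint x y z (Y_idx i) = z 0 i.
Proof. by rewrite /fpoint row_mxEr. Qed.
Definition fpointE := (fpoint_xi, fpoint_eta, fpoint_Y).
End Fpoint.

(** * From the Lie algebra sp(2n) to transvections *)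

Section SpInvariants.
Variables (R : numFieldType) (n : nat).
Local Notation N := (n + n + 1)%N.
Local Notation M := (N + N + N)%N.
Local Notation s_ := (@lshift (n + n) 1).
Local Notation J := (sympJ n).
Implicit Types (P : mpoly M R).

(* The infinitesimal transvection attached to the symmetric product of the a-th and
   b-th basis covectors, up to symmetrization in (a, b). *)
Definition sp_op (a b : 'I_(n + n)) P : mpoly M R :=
  \sum_i J R b i *: (var (Y_idx (s_ a)) * mderiv (Y_idx (s_ i)) P
    - var (xi_idx (s_ i)) * mderiv (xi_idx (s_ a)) P
    - var (eta_idx (s_ i)) * mderiv (eta_idx (s_ a)) P).

Definition sp_invariant P : Prop := forall a b, sp_op a b P + sp_op b a P = 0.

Lemma map_sympJ (A B : pzRingType) (f : {rmorphism A -> B}) :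
  map_mx f (J A) = J B.
Proof. by rewrite map_block_mx !map_mx0 map_mxN map_mx1. Qed.

Lemma rmorph_sympJ (A B : pzRingType) (f : {rmorphism A -> B}) i j :
  f (J A i j) = J B i j.
Proof. by rewrite -(map_sympJ f) [RHS]mxE. Qed.

Section Evaluation.
Variables (K : fieldType) (f : {rmorphism R -> K}) (P : mpoly M R).
Hypothesis K0 : [pchar K] =i pred0.
Hypothesis P_inv : sp_invariant P.

(* [fun y => y *m J] identifies vectors with covectors, so that transvections act on
   the three arguments in the same way. *)
Definition eval3 (t1 t2 t3 : 'M[K]_1) (v1 v2 v3 : 'rV[K]_(n + n)) : K :=
  mmap f (fpoint (row_mx v1 t1) (row_mx v2 t2) (row_mx (v3 *m J K) t3)) P.

(** The coefficients u_a u_b single out the infinitesimal transvection along [u]. They are symmetric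
    in (a, b), whereas invariance makes the values of [sp_op] antisymmetric, so the sum is its own
    opposite. *)
Lemma sp_op_quadratic (u : 'rV[K]_(n + n)) (h : 'I_M -> {poly K}) :
  \sum_a \sum_b (u 0 a * u 0 b)%:P * mmap (polyC \o f) h (sp_op a b P) = 0.
Proof.
pose F a b := mmap (polyC \o f) h (sp_op a b P).
have FN a b : F b a = - F a b.
  by apply/eqP; rewrite -addr_eq0 /F -mmapD P_inv mmap0.
pose S := \sum_a \sum_b (u 0 a * u 0 b)%:P * F a b.
rewrite -[LHS]/S; have SN : S = - S.
  rewrite {1}/S exchange_big -sumrN; apply: eq_bigr => a _.
  rewrite -sumrN; apply: eq_bigr => b _.
  by rewrite FN mulrN [u 0 b * _]mulrC.
have /eqP : S + S = 0 by rewrite {1}SN addNr.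
rewrite -mulr2n -mulr_natr mulf_eq0 => /orP[/eqP //|].
by rewrite -polyC_natr polyC_eq0 (pcharf0P K).1.
Qed.

(** The infinitesimal transvection along [u] has square 0, so the path from a triple to its image is
    a segment, and the derivative of [P] along it is the infinitesimal action at the current
    point. *)
Lemma eval3_transv t1 t2 t3 u s v1 v2 v3 :
  eval3 t1 t2 t3 (transv u s v1) (transv u s v2) (transv u s v3) =
  eval3 t1 t2 t3 v1 v2 v3.
Proof.
(* [h0] is the initial point, [h1] the displacement and [h] the segment with parameter 'X; the
   components along t do not move. *)
pose h0 := fpoint (row_mx v1 t1) (row_mx v2 t2) (row_mx (v3 *m J K) t3).
pose h1 := fpoint (row_mx ((s * symp v1 u) *: u) 0) (row_mx ((s * symp v2 u) *: u) 0)
  (row_mx ((s * symp v3 u) *: (u *m J K)) (0 : 'M[K]_1)).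
pose h i := (h0 i)%:P + 'X * (h1 i)%:P.
pose D j := mmap (polyC \o f) h (mderiv j P).
pose g := mmap (polyC \o f) h P.
have g_eval t : g.[t] = mmap f (fun i => h0 i + t * h1 i) P.
  rewrite -[LHS]/(horner_eval t g) /g rmorph_mmap; apply: eq_mmap => i /=.
    by rewrite /horner_eval hornerC.
  by rewrite /horner_eval /h !hornerE.
have dg : deriv g = 0.
  rewrite /g (mmap_chain _ _ (D := deriv (R := K))); first last.
  - by move=> c; rewrite /= derivC.
  - by move=> a b; rewrite /= derivM.
  have dh j : deriv (h j) = (h1 j)%:P by rewrite /h derivD derivM derivX !derivC mul1r mulr0 addr0 add0r.
  have symp_sum (v w : 'rV_(n + n)) : \sum_i (v *m J K) 0 i * w 0 i = symp v w.
    by rewrite /symp [RHS]mxE; apply: eq_bigr => i _; rewrite [w^T _ _]mxE.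
  have sumP (r w w' : 'rV[K]_(n + n)) (c : K) : \sum_i (r 0 i)%:P *
      ((w 0 i)%:P + 'X * ((c *: w') 0 i)%:P) =
      (\sum_i r 0 i * w 0 i)%:P + 'X * (c * \sum_i r 0 i * w' 0 i)%:P.
    rewrite mulr_sumr !rmorph_sum mulr_sumr -big_split; apply: eq_bigr => i _ /=.
    by rewrite mxE !polyCM; ring.
  (* The pairings with [u] are constant along the segment since [symp u u] is 0. This identifies the
     constant velocity [h1] with the infinitesimal transvection at every point of the segment. *)
  have h_xi : \sum_i ((u *m J K) 0 i)%:P * h (xi_idx (s_ i)) = - (symp v1 u)%:P.
    under eq_bigr => i _ do rewrite /h /h0 /h1 !fpointE !row_mxEl.
    by rewrite sumP !symp_sum symp_self mulr0 polyC0 mulr0 addr0 sympC polyCN.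
  have h_eta : \sum_i ((u *m J K) 0 i)%:P * h (eta_idx (s_ i)) = - (symp v2 u)%:P.
    under eq_bigr => i _ do rewrite /h /h0 /h1 !fpointE !row_mxEl.
    by rewrite sumP !symp_sum symp_self mulr0 polyC0 mulr0 addr0 sympC polyCN.
  have h_Y : \sum_i (u 0 i)%:P * h (Y_idx (s_ i)) = (symp v3 u)%:P.
    under eq_bigr => i _ do rewrite /h /h0 /h1 !fpointE !row_mxEl.
    have symp_sum' (w : 'rV_(n + n)) : \sum_i u 0 i * (w *m J K) 0 i = symp w u.
      by rewrite -symp_sum; apply: eq_bigr => i _; rewrite mulrC.
    by rewrite sumP !symp_sum' symp_self mulr0 polyC0 mulr0 addr0.
  transitivity (s%:P *
      \sum_a \sum_b (u 0 a * u 0 b)%:P * mmap (polyC \o f) h (sp_op a b P)); last first.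
    by rewrite sp_op_quadratic mulr0.
  transitivity (\sum_j (h1 j)%:P * D j).
    by apply: eq_bigr => j _; rewrite /= dh.
  have -> : \sum_a \sum_b (u 0 a * u 0 b)%:P * mmap (polyC \o f) h (sp_op a b P) =
      \sum_a \sum_i (u 0 a)%:P * ((u *m J K) 0 i)%:P *
        (h (Y_idx (s_ a)) * D (Y_idx (s_ i)) - h (xi_idx (s_ i)) * D (xi_idx (s_ a))
         - h (eta_idx (s_ i)) * D (eta_idx (s_ a))).
    apply: eq_bigr => a _.
    under eq_bigr => b _ do rewrite /sp_op rmorph_sum mulr_sumr.
    rewrite exchange_big; apply: eq_bigr => i _ /=.
    rewrite [(u *m J K) 0 i]mxE rmorph_sum [in RHS]mulr_sumr [RHS]mulr_suml; apply: eq_bigr => b _ /=.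
    rewrite mmapZ !rmorphB !rmorphM /= !mmap_var rmorph_sympJ /D; ring.
  have bilin (c d : 'I_(n + n) -> K) (x y : 'I_(n + n) -> {poly K}) :
      \sum_a \sum_i (c a)%:P * (d i)%:P * (x i * y a) =
      (\sum_i (d i)%:P * x i) * \sum_a (c a)%:P * y a.
    rewrite mulr_sumr; apply: eq_bigr => a _. rewrite mulr_suml.
    by apply: eq_bigr => i _; ring.
  have -> : \sum_a \sum_i (u 0 a)%:P * ((u *m J K) 0 i)%:P *
        (h (Y_idx (s_ a)) * D (Y_idx (s_ i)) - h (xi_idx (s_ i)) * D (xi_idx (s_ a))
         - h (eta_idx (s_ i)) * D (eta_idx (s_ a))) =
      (symp v3 u)%:P * (\sum_i ((u *m J K) 0 i)%:P * D (Y_idx (s_ i)))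
      + (symp v1 u)%:P * (\sum_a (u 0 a)%:P * D (xi_idx (s_ a)))
      + (symp v2 u)%:P * (\sum_a (u 0 a)%:P * D (eta_idx (s_ a))).
    rewrite -h_Y -[(symp v1 u)%:P]opprK -[(symp v2 u)%:P]opprK -h_xi -h_eta.
    rewrite !mulNr -!bilin [in RHS]exchange_big -!sumrB; apply: eq_bigr => a _.
    by rewrite -!sumrB; apply: eq_bigr => i _ /=; ring.
  rewrite sum_fvar !sum_phase.
  have h1t : [/\ h1 (xi_idx (it n)) = 0, h1 (eta_idx (it n)) = 0 & h1 (Y_idx (it n)) = 0].
    by rewrite /h1 !fpointE !row_mxEr !mxE.
  case: h1t => -> -> ->; rewrite polyC0 !mul0r !addr0 [RHS]mulrDr [X in _ = X + _]mulrDr.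
  rewrite -[RHS]addrA [RHS]addrC; congr (_ + _ + _);
    rewrite mulrA [RHS]mulr_sumr; apply: eq_bigr => i _; rewrite /h1 !fpointE row_mxEl mxE !polyCM;
    ring.
have gE : g.[1] = g.[0] by rewrite (deriv0_const K0 dg) !hornerC.
rewrite !g_eval in gE; rewrite /eval3; transitivity (mmap f (fun i => h0 i + 1 * h1 i) P).
  apply: eq_mmap => //; elim/fvarP => i; rewrite mul1r /h0 /h1 !fpointE /transv;
    case: (split_ordP i) => j ->; rewrite ?row_mxEl ?row_mxEr ?mulmxDl -?scalemxAl;
    by [rewrite [LHS]mxE|rewrite [const_mx _ _ _]mxE addr0].
by rewrite gE; apply: eq_mmap => // i; rewrite mul0r addr0.
Qed.

Lemma eval3_poly t1 t2 t3 v1 v2 v3 w :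
  exists p : {poly K}, forall t, eval3 t1 t2 t3 v1 v2 (v3 + t *: w) = p.[t].
Proof.
exists (mmap (polyC \o f) (fun i =>
  (fpoint (row_mx v1 t1) (row_mx v2 t2) (row_mx (v3 *m J K) t3) i)%:P +
  'X * (fpoint 0 0 (row_mx (w *m J K) 0) i)%:P) P) => t.
rewrite -[RHS]/(horner_eval t _) rmorph_mmap; apply: eq_mmap => [c|] /=.
  by rewrite /horner_eval hornerC.
elim/fvarP => i /=; rewrite /horner_eval !hornerE !fpointE ?[const_mx _ _ _]mxE ?mulr0 ?addr0 //.
by rewrite mulmxDl -scalemxAl; case: (split_ordP i) => j ->;
   rewrite ?row_mxEl ?row_mxEr !mxE ?mulr0 ?addr0.
Qed.

End Evaluation.
End SpInvariants.

(** * The first fundamental theorem for two covectors and a vector *)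

Section FirstFundamentalTheorem.
Variables (R : numFieldType) (n : nat).
Local Notation N := (n + n + 1)%N.
Local Notation M := (N + N + N)%N.
Local Notation s_ := (@lshift (n + n) 1).
Local Notation J := (sympJ n).
Local Notation tofrac := (@FracField.tofrac _).

Definition sp_gen (i : 'I_6) : mpoly M R := nth 0
  [:: \sum_k (var (xi_idx (ip k)) * var (eta_idx (iq k))
              - var (xi_idx (iq k)) * var (eta_idx (ip k)));
      \sum_i var (xi_idx (s_ i)) * var (Y_idx (s_ i));
      \sum_i var (eta_idx (s_ i)) * var (Y_idx (s_ i));
      var (xi_idx (it n)); var (eta_idx (it n)); var (Y_idx (it n))] i.

Local Notation sp_comp := (mmap (mpolyC M (R := R)) sp_gen).

Lemma sp_genE (K : comNzRingType) (f : {rmorphism R -> K}) (h : 'I_M -> K) i :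
  mmap f h (sp_gen i) = nth 0
  [:: \sum_k (h (xi_idx (ip k)) * h (eta_idx (iq k))
              - h (xi_idx (iq k)) * h (eta_idx (ip k)));
      \sum_i h (xi_idx (s_ i)) * h (Y_idx (s_ i));
      \sum_i h (eta_idx (s_ i)) * h (Y_idx (s_ i));
      h (xi_idx (it n)); h (eta_idx (it n)); h (Y_idx (it n))] i.
Proof.
case: i => [[|[|[|[|[|[|//]]]]]] lt6]; rewrite /sp_gen /= ?mmap_var //.
all: rewrite rmorph_sum; apply: eq_bigr => k _ /=.
all: by rewrite ?rmorphB ?rmorphM /= !mmap_var.
Qed.

Lemma mmap_sp_comp (K : comNzRingType) (f : {rmorphism R -> K}) (h : 'I_M -> K) G :
  mmap f h (sp_comp G) = mmap f (fun i => mmap f h (sp_gen i)) G.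
Proof.
by rewrite rmorph_mmap; apply: eq_mmap => // c /=; rewrite mmapC.
Qed.

Lemma pchar_ext (K : fieldType) (f : {rmorphism R -> K}) : [pchar K] =i pred0.
Proof.
apply/pcharf0P=> m; rewrite -(rmorph_nat f).
have [->|m0] := eqVneq m 0%N; first by rewrite rmorph0 eqxx.
by rewrite fmorph_eq0 Num.Theory.pnatr_eq0 (negPf m0).
Qed.

Section Fpoint3.
Variables (K : fieldType) (f : {rmorphism R -> K}).
Variables (v1 v2 w : 'rV[K]_(n + n)) (t1 t2 t3 : 'M[K]_1).
Let h := fpoint (row_mx v1 t1) (row_mx v2 t2) (row_mx w t3).

Lemma sp_gen_fpoint i : mmap f h (sp_gen i) = nth 0
  [:: symp v1 v2; (v1 *m w^T) 0 0; (v2 *m w^T) 0 0; t1 0 0; t2 0 0; t3 0 0] i.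
Proof.
rewrite sp_genE sympE !(mxE _ _ 0 0).
case: i => [[|[|[|[|[|[|//]]]]]] lt6] /=; try apply: eq_bigr => k _.
all: by rewrite /h !fpointE ?row_mxEl ?row_mxEr ?[_^T _ _]mxE.
Qed.

End Fpoint3.

Variable k0 : 'I_n.

Local Notation o0 := (@Ordinal 6 0 isT).
Local Notation o1 := (@Ordinal 6 1 isT).
Local Notation o2 := (@Ordinal 6 2 isT).

(* The generators are algebraically independent, even modulo [sp_gen o0], as the
   point xi = e, eta = (c / b) e, Y = b e shows. *)
Lemma sp_comp_dvd P G : sp_gen o0 * P = sp_comp G ->
  exists G', G = var o0 * G'.
Proof.
move=> PG; have [G' GE] := mpoly_split_var o0 G; exists G'.
rewrite {1}GE; set G0 := mmap _ _ _; suff -> : G0 = 0 by rewrite add0r.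
pose K := {fraction mpoly 6 R}.
pose f : {rmorphism R -> K} := tofrac \o mpolyC 6 (R := R).
pose X i : K := tofrac (var (inord i)).
pose e : 'rV[K]_(n + n) := delta_mx 0 (lshift n k0).
pose h := fpoint (row_mx e (X 3)%:M) (row_mx ((X 2 / X 1) *: e) (X 4)%:M)
                 (row_mx (X 1 *: e) (X 5)%:M).
have X1 : X 1%N != 0.
  by rewrite /X tofrac_eq0 -msupp_eq0 msuppX //.
have gE i : mmap f h (sp_gen i) = tofrac (if i == o0 then 0 else var i).
  have ee : (e *m e^T) 0 0 = 1 by rewrite trmx_delta mul_delta_mx mxE !eqxx.
  have XE (j : 'I_6) : X j = tofrac (var j) by rewrite /X inord_val.
  rewrite sp_gen_fpoint; case: i => [[|[|[|[|[|[|//]]]]]] lt6];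
    rewrite -?[tofrac (var (Ordinal _))]XE /= ?[_%:M _ _]mxE ?mulr1n //.
  - by rewrite sympZr symp_self mulr0 rmorph0.
  - by rewrite linearZ -scalemxAr mxE ee mulr1.
  - by rewrite linearZ -scalemxAr -scalemxAl [LHS]mxE [X in _ * X]mxE ee mulr1 mulrC divfK.
apply/eqP; rewrite -tofrac_eq0; apply/eqP.
have := congr1 (mmap f h) PG; rewrite rmorphM /= gE eqxx rmorph0 mul0r mmap_sp_comp => ->.
by rewrite /G0 rmorph_mmap; apply: eq_mmap => // i; rewrite gE.
Qed.

Lemma sp_gen0_neq0 : sp_gen o0 != 0.
Proof.
pose h : 'I_M -> R := fpoint (row_mx (delta_mx 0 (lshift n k0)) 0)
  (row_mx (delta_mx 0 (rshift n k0)) 0) (row_mx 0 0).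
apply/eqP => /(congr1 (mmap idfun h)) /eqP.
by rewrite sp_gen_fpoint symp_ef rmorph0 oner_eq0.
Qed.

Lemma sp_comp_descent P G m : sp_gen o0 ^+ m * P = sp_comp G ->
  exists G', P = sp_comp G'.
Proof.
elim: m G => [|m IH] G; first by rewrite mul1r; exists G.
rewrite exprS -mulrA => /[dup] aPG /sp_comp_dvd[G' GE].
apply: (IH G'); apply: (mulfI sp_gen0_neq0); rewrite aPG GE rmorphM; congr (_ * _).
by rewrite /= mmap_var.
Qed.

Theorem sp_first_fundamental_theorem (P : mpoly M R) : sp_invariant P ->
  exists G, P = sp_comp G.
Proof.
move=> Pinv; pose K := {fraction mpoly M R}.
pose f : {rmorphism R -> K} := tofrac \o mpolyC M (R := R).
pose x j : K := tofrac (var j).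
pose v1 : 'rV[K]_(n + n) := \row_i x (xi_idx (s_ i)).
pose v2 : 'rV[K]_(n + n) := \row_i x (eta_idx (s_ i)).
pose w : 'rV[K]_(n + n) := \row_i x (Y_idx (s_ i)).
pose t1 : 'M[K]_1 := (x (xi_idx (it n)))%:M.
pose t2 : 'M[K]_1 := (x (eta_idx (it n)))%:M.
pose t3 : 'M[K]_1 := (x (Y_idx (it n)))%:M.
pose v3 : 'rV[K]_(n + n) := - (w *m J K).
pose X i : K := tofrac (sp_gen i).
have v3w : v3 *m J K = w by rewrite /v3 mulNmx -mulmxA sympJ_sqr mulmxN mulmx1 opprK.
(* Evaluation at the generic point is the embedding of polynomials into fractions, so nothing is
   lost. *)
have QE Q : tofrac Q = mmap f (fpoint (row_mx v1 t1) (row_mx v2 t2) (row_mx w t3)) Q.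
  rewrite -{1}(mmap_id Q) rmorph_mmap; apply: eq_mmap => //; elim/fvarP => i /=;
  by rewrite !fpointE; case: (split_ordP i) => j ->;
     rewrite ?row_mxEl ?row_mxEr !mxE ?ord1 ?mulr1n.
have PE : tofrac P = eval3 f P t1 t2 t3 v1 v2 v3 by rewrite QE /eval3 v3w.
have symp12 : symp v1 v2 = X o0 by rewrite /X QE sp_gen_fpoint.
(* Since Y_s is [v3 *m J], duality with Y_s is the opposite of the symplectic pairing with [v3];
   hence the signs below. *)
have symp_v3 u : symp u v3 = - (u *m w^T) 0 0.
  rewrite /symp /v3 linearN /= trmx_mul tr_sympJ mulNmx opprK -mulmxA.
  by rewrite (mulmxA (J K)) sympJ_sqr mulNmx mul1mx mulmxN mxE.
have symp13 : symp v1 v3 = - X o1 by rewrite symp_v3 /X QE sp_gen_fpoint.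
have symp23 : symp v2 v3 = - X o2 by rewrite symp_v3 /X QE sp_gen_fpoint.
have a0 : X o0 != 0 by rewrite /X tofrac_eq0 sp_gen0_neq0.
pose g : {rmorphism mpoly 6 R -> K} := tofrac \o sp_comp.
(* [C] is the ring of polynomials in the generators, localized at a = [X o0]. It contains the
   coordinates of the normal form, hence the value of [P] there. *)
pose C (z : K) := exists m G, X o0 ^+ m * z = g G.
have gE i : g (var i) = X i by rewrite /g /= mmap_var.
have CD z z' : C z -> C z' -> C (z + z').
  move=> [m [G zG]] [m' [G' zG']]; exists (m + m')%N.
  exists (var o0 ^+ m' * G + var o0 ^+ m * G').
  by rewrite rmorphD !rmorphM !rmorphXn gE -zG -zG' exprD; ring.
have CM z z' : C z -> C z' -> C (z * z').
  move=> [m [G zG]] [m' [G' zG']]; exists (m + m')%N, (G * G').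
  by rewrite rmorphM -zG -zG' exprD; ring.
have CX i : C (X i) by exists 0%N, (var i); rewrite mul1r gE.
have Cf c : C (f c) by exists 0%N, (mpolyC 6 c); rewrite mul1r /g /= mmapC.
have C0 : C 0 by rewrite -(rmorph0 f).
have C1 : C 1 by rewrite -(rmorph1 f).
have CN z : C z -> C (- z).
  by move=> Cz; rewrite -mulN1r -(rmorphN1 f); exact: CM.
have CV : C (X o0)^-1 by exists 1%N, 1; rewrite mulfV // rmorph1.
suff [m [G PG]] : C (tofrac P).
  apply: (@sp_comp_descent P G m); apply/eqP; rewrite -tofrac_eq rmorphM rmorphXn.
  exact/eqP.
have Ceval h Q : (forall i, C (h i)) -> C (mmap f h Q).
  move=> Ch; elim/mpoly_ring_ind: Q => [c|i|p q|p q].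
  - by rewrite mmapC; exact: Cf.
  - by rewrite mmap_var.
  - by rewrite mmapD; exact: CD.
  - by rewrite rmorphM; exact: CM.
(* The triple is generic: its pairing a is nonzero, and the pairing of [v1] with e is the opposite
   of a variable. *)
rewrite PE (@slice n K k0); first last.
- by rewrite symp12.
- by rewrite symp_el oppr_eq0 mxE /x tofrac_eq0 -msupp_eq0 msuppX.
- by move=> *; exact: eval3_poly.
- by move=> *; apply: eval3_transv => //; exact: pchar_ext f.
- exact: pchar_ext f.
rewrite symp12 symp13 symp23; apply: Ceval.
have Crow (r : 'rV[K]_(n + n)) (t : 'M[K]_1) : (forall i, C (r 0 i)) -> C (t 0 0) ->
    forall i, C (row_mx r t 0 i).
  move=> Cr Ct i; case: (split_ordP i) => j ->; rewrite ?row_mxEl ?row_mxEr //.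
  by rewrite ord1.
have Cdelta i j : C ((delta_mx 0 i : 'rV[K]_(n + n)) 0 j).
  by rewrite mxE; case: (_ && _).
have CZ (z : K) (r : 'rV[K]_(n + n)) : C z -> (forall i, C (r 0 i)) ->
    forall i, C ((z *: r) 0 i).
  by move=> Cz Cr i; rewrite mxE; apply: CM.
rewrite mulmxBl -!scalemxAl.
have CJ i j : C (((delta_mx 0 i : 'rV[K]_(n + n)) *m J K) 0 j).
  rewrite -rowE mxE -(rmorph_sympJ f); exact: Cf.
elim/fvarP => i; rewrite fpointE; apply: Crow => {i} [i|].
- exact: Cdelta.
- by rewrite mxE mulr1n -[x _]/(X (@Ordinal 6 3 isT)).
- by apply: CZ => [|j]; [exact: CX|exact: Cdelta].
- by rewrite mxE mulr1n -[x _]/(X (@Ordinal 6 4 isT)).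
- rewrite mxE; apply: CD; first by apply: CZ => [|j]; [exact/CN/CX|exact: CJ].
  rewrite mxE; apply: (CN); apply: CZ => [|j]; last exact: CJ.
  by apply: CM => //; apply: CN.
- by rewrite mxE mulr1n -[x _]/(X (@Ordinal 6 5 isT)).
Qed.

End FirstFundamentalTheorem.

(** * Lie derivatives of symbols *)

Section LieDerivative.
Variables (R : realType) (N : nat).
Local Notation F := (Cinf R N).
Local Notation xi_ := (@Defs.xi R N).
Local Notation eta_ := (@Defs.eta R N).
Local Notation Y_ := (@Defs.Y R N).
Implicit Types (f g : F) (P Q : fpoly R N) (X : vfield R N) (nu mu : R) (S : symb R N).

Lemma Cinf_derivable f i x : derivable f x 'e_i.
Proof. by have /smoothP/(_ 1%N)[_ /(_ i)[]] := CinfP f. Qed.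

Lemma dCM (i : 'I_N) f g : dC i (f * g) = dC i f * g + f * dC i g.
Proof.
apply: val_inj; apply/funext => x.
transitivity (f x * pd i g x + g x * pd i f x); last by rewrite addrC mulrC.
change (pd i ((f : 'rV[R]_N -> R) * (g : 'rV[R]_N -> R)) x = f x * pd i g x + g x * pd i f x).
by apply: deriveM; exact: Cinf_derivable.
Qed.

Lemma dC_cst i (c : R) : dC i (cstC N c) = 0.
Proof. by apply: val_inj; rewrite /= pd_cst. Qed.

Lemma dC_coord (i j : 'I_N) : dC i (Defs.coord R j) = (j == i)%:R.
Proof.
apply: val_inj; apply/funext => x; rewrite -(rmorph_nat (cstC N)) /=.
have cc : continuous (fun x : 'rV[R]_N => x 0 j) by exact: coord_continuous.
have @l : {linear 'rV[R]_N -> R}.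
  by exists (fun x : 'rV[R]_N => x 0 j); do 2![eexists]; do ?[constructor];
     rewrite ?mxE// => ? *; rewrite ?mxE//; move=> ?; rewrite !mxE.
rewrite /pd deriveE; last exact: differentiable_coord.
by rewrite (_ : (fun _ => _) = l) // diff_lin //= mxE eqxx.
Qed.

Definition derivation (D : fpoly R N -> fpoly R N) : Prop :=
  zmod_morphism D /\ forall P Q, D (P * Q) = D P * Q + P * D Q.

Lemma derivation_sum (D : 'I_N -> fpoly R N -> fpoly R N) :
  (forall i, derivation (D i)) -> derivation (fun Q => \sum_i D i Q).
Proof.
move=> der; split => P Q.
  by rewrite -sumrB; apply: eq_bigr => i _; have [DB _] := der i; exact: DB.
rewrite mulr_suml mulr_sumr -big_split /=.
by apply: eq_bigr => i _; have [_ DM] := der i; exact: DM.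
Qed.

Lemma derivation_scale (D : fpoly R N -> fpoly R N) f :
  derivation D -> derivation (fun Q => f *: D Q).
Proof.
move=> [DB DM]; split => P Q; first by rewrite DB scalerBr.
by rewrite DM scalerDr scalerAl scalerAr.
Qed.

Lemma derivation_mul (D : fpoly R N -> fpoly R N) p :
  derivation D -> derivation (fun Q => p * D Q).
Proof.
move=> [DB DM]; split => P Q; first by rewrite DB mulrBr.
by rewrite DM mulrDr mulrA mulrCA.
Qed.

Lemma derivationD (D D' : fpoly R N -> fpoly R N) :
  derivation D -> derivation D' -> derivation (fun Q => D Q + D' Q).
Proof.
move=> [DB DM] [DB' DM']; split => P Q; first by rewrite DB DB'; ring.
by rewrite DM DM'; ring.
Qed.

Lemma derivationN (D : fpoly R N -> fpoly R N) :
  derivation D -> derivation (fun Q => - D Q).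
Proof.
move=> [DB DM]; split => P Q; first by rewrite DB; ring.
by rewrite DM; ring.
Qed.

Lemma derivation_dfvar j : derivation (dfvar j).
Proof. by split => P Q; [exact: mderivB|exact: mderivM]. Qed.

Lemma derivation_dcoef i : derivation (dcoef i).
Proof.
split => P Q; first exact: raddfB.
apply/mpolyP => m; rewrite /dcoef mcoeff_map_mpoly mcoeffD !mcoeffM.
rewrite raddf_sum -big_split; apply: eq_bigr => k _ /=.
by rewrite !mcoeff_map_mpoly dCM.
Qed.

Definition divergence X : F := \sum_i dC i (X i).

(** The part of [lie] that does not depend on the weight; unlike [lie nu], it is a derivation for
    every field. *)
Definition lie_tensor X Q : fpoly R N :=
  \sum_i X i *: dcoef i Q
  - \sum_i \sum_j dC j (X i) *: (eta_ i * dfvar (eta_idx j) Q)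
  - \sum_i \sum_j dC j (X i) *: (xi_ i * dfvar (xi_idx j) Q)
  + \sum_i \sum_j dC j (X i) *: (Y_ j * dfvar (Y_idx i) Q).

Lemma lieE nu X Q : lie nu X Q = lie_tensor X Q + (cstC N nu * divergence X) *: Q.
Proof. by []. Qed.

Lemma lie0E X Q : lie 0 X Q = lie_tensor X Q.
Proof. by rewrite lieE rmorph0 mul0r scale0r addr0. Qed.

Lemma lie_tensor_derivation X : derivation (lie_tensor X).
Proof.
apply: derivationD; [apply: derivationD; [apply: derivationD|apply: derivationN]|].
- by apply: derivation_sum => i; apply: derivation_scale; exact: derivation_dcoef.
- apply: derivationN; apply: derivation_sum => i; apply: derivation_sum => j.
  by apply: derivation_scale; apply: derivation_mul; exact: derivation_dfvar.
all: apply: derivation_sum => i; apply: derivation_sum => j.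
all: by apply: derivation_scale; apply: derivation_mul; exact: derivation_dfvar.
Qed.

Lemma lie_tensorM X P Q :
  lie_tensor X (P * Q) = lie_tensor X P * Q + P * lie_tensor X Q.
Proof. by have [_] := lie_tensor_derivation X. Qed.

HB.instance Definition _ X :=
  GRing.isZmodMorphism.Build (fpoly R N) (fpoly R N) (lie_tensor X)
    (lie_tensor_derivation X).1.

Fact lie_zmod nu X : zmod_morphism (lie nu X).
Proof.
move=> P Q; rewrite (lieE nu X (P - Q)) (lieE nu X P) (lieE nu X Q).
rewrite (raddfB (lie_tensor X)).
by rewrite scalerBr [in RHS]opprD [RHS]addrACA.
Qed.
HB.instance Definition _ nu X :=
  GRing.isZmodMorphism.Build (fpoly R N) (fpoly R N) (lie nu X) (@lie_zmod nu X).

(** The divergence term is linear in the weight, so adding weights gives exactly the Leibniz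
    rule. *)
Lemma lieM nu mu X P Q :
  lie (nu + mu) X (P * Q) = lie nu X P * Q + P * lie mu X Q.
Proof.
have aux (a b u v p q : fpoly R N) :
  a * q + p * b + (u + v) * (p * q) = (a + u * p) * q + p * (b + v * q) by ring.
rewrite (lieE _ X (P * Q)) (lieE nu) (lieE mu) lie_tensorM rmorphD (mulrDl (cstC N nu)) scalerDl.
rewrite -(mul_mpolyC _ P) -(mul_mpolyC _ Q) -2!(mul_mpolyC _ (P * Q)) -mulrDl.
exact: aux.
Qed.

Lemma dcoef_fvar (i : 'I_N) j : dcoef i (fvar R j) = 0.
Proof.
apply/mpolyP => m; rewrite /dcoef mcoeff_map_mpoly mcoeffX mcoeff0.
by rewrite -(rmorph_nat (@cstC R N)) /= dC_cst.
Qed.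

Lemma dfvar_fvar (i j : 'I_(N + N + N)) : dfvar i (fvar R j) = (j == i)%:R.
Proof. exact: mderiv_var. Qed.

Lemma lie_tensorC X f :
  lie_tensor X (mpolyC _ f) = mpolyC _ (\sum_i X i * dC i f).
Proof.
rewrite /lie_tensor rmorph_sum /=.
have -> : \sum_i X i *: dcoef i (mpolyC (N + N + N) f)
    = \sum_i mpolyC (N + N + N) (X i * dC i f).
  by apply: eq_bigr => i _; rewrite /dcoef map_mpolyC -mul_mpolyC rmorphM.
have vert0 v k : v * dfvar k (mpolyC (N + N + N) f) = 0.
  by rewrite /dfvar mderivC mulr0.
rewrite [X in _ + X]big1 => [|i _]; last first.
  by rewrite big1 // => j _; rewrite vert0 scaler0.
rewrite [X in _ - X + _]big1 => [|i _]; last first.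
  by rewrite big1 // => j _; rewrite vert0 scaler0.
rewrite [X in _ - X - _]big1 => [|i _]; last first.
  by rewrite big1 // => j _; rewrite vert0 scaler0.
by rewrite !subr0 addr0.
Qed.

Lemma lie_tensorZ X f Q :
  lie_tensor X (f *: Q) = (\sum_i X i * dC i f) *: Q + f *: lie_tensor X Q.
Proof. by rewrite -!mul_mpolyC lie_tensorM lie_tensorC. Qed.

Lemma lie_tensor_xi X j : lie_tensor X (xi_ j) = - \sum_i dC j (X i) *: xi_ i.
Proof.
rewrite /lie_tensor.
rewrite [X in X - _ - _ + _]big1 => [|i _]; last by rewrite dcoef_fvar scaler0.
rewrite [X in _ - X - _ + _]big1 => [|i _]; last first.
  rewrite big1 // => k _; rewrite dfvar_fvar (inj_eq (@lshift_inj _ _)).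
  by rewrite eq_lrshift mulr0 scaler0.
rewrite [X in _ + X]big1 => [|i _]; last first.
  by rewrite big1 // => k _; rewrite dfvar_fvar eq_lrshift mulr0 scaler0.
rewrite subr0 sub0r addr0; congr (- _); apply: eq_bigr => i _.
rewrite (bigD1 j) //= dfvar_fvar eqxx mulr1 big1 ?addr0 // => k kj.
rewrite dfvar_fvar !(inj_eq (@lshift_inj _ _)) eq_sym (negPf kj).
by rewrite mulr0 scaler0.
Qed.

Lemma lie_tensor_eta X j : lie_tensor X (eta_ j) = - \sum_i dC j (X i) *: eta_ i.
Proof.
rewrite /lie_tensor.
rewrite [X in X - _ - _ + _]big1 => [|i _]; last by rewrite dcoef_fvar scaler0.
rewrite [X in _ - _ - X + _]big1 => [|i _]; last first.
  rewrite big1 // => k _; rewrite dfvar_fvar (inj_eq (@lshift_inj _ _)).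
  by rewrite eq_rlshift mulr0 scaler0.
rewrite [X in _ + X]big1 => [|i _]; last first.
  by rewrite big1 // => k _; rewrite dfvar_fvar eq_lrshift mulr0 scaler0.
rewrite subr0 sub0r addr0; congr (- _); apply: eq_bigr => i _.
rewrite (bigD1 j) //= dfvar_fvar eqxx mulr1 big1 ?addr0 // => k kj.
rewrite dfvar_fvar (inj_eq (@lshift_inj _ _)) (inj_eq (@rshift_inj _ _)).
by rewrite eq_sym (negPf kj) mulr0 scaler0.
Qed.

Lemma lie_tensor_Y X i : lie_tensor X (Y_ i) = \sum_j dC j (X i) *: Y_ j.
Proof.
rewrite /lie_tensor.
rewrite [X in X - _ - _ + _]big1 => [|k _]; last by rewrite dcoef_fvar scaler0.
rewrite [X in _ - X - _ + _]big1 => [|k _]; last first.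
  by rewrite big1 // => j _; rewrite dfvar_fvar eq_rlshift mulr0 scaler0.
rewrite [X in _ - _ - X + _]big1 => [|k _]; last first.
  by rewrite big1 // => j _; rewrite dfvar_fvar eq_rlshift mulr0 scaler0.
rewrite !subr0 add0r (bigD1 i) //= [X in _ + X]big1 ?addr0 => [|k ki].
  by apply: eq_bigr => j _; rewrite dfvar_fvar eqxx mulr1.
rewrite big1 // => j _; rewrite dfvar_fvar (inj_eq (@rshift_inj _ _)).
by rewrite eq_sym (negPf ki) mulr0 scaler0.
Qed.

Lemma gcoef_symb_lie X S nu : gcoef nu (symb_lie X S) = lie nu X (gcoef nu S).
Proof.
rewrite /symb_lie raddf_sum /=.
under eq_bigr => g _ do rewrite gcoef_mono.
have [nuS|nuS] := boolP (nu \in gsupp S).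
  rewrite (big_fsetD1 nu) //= eqxx mulr1n big_seq big1 ?addr0 // => g.
  by rewrite !inE => /andP[/negPf ->]; rewrite mulr0n.
rewrite gcoef_out // raddf0 big_seq big1 // => g gS.
by case: eqP => // gnu; rewrite gnu (negPf nuS) in gS.
Qed.

Fact symb_lie_zmod X : zmod_morphism (symb_lie X).
Proof.
by move=> S S'; apply/galgP => nu; rewrite raddfB /= !gcoef_symb_lie !raddfB.
Qed.
HB.instance Definition _ X :=
  GRing.isZmodMorphism.Build (symb R N) (symb R N) (symb_lie X) (@symb_lie_zmod X).

Lemma symb_lie_gmono X nu Q : symb_lie X (gmono nu Q) = gmono nu (lie nu X Q).
Proof.
apply/galgP => mu; rewrite gcoef_symb_lie !gcoef_mono.
by case: eqP => [->|_]; rewrite ?mulr1n // !mulr0n raddf0.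
Qed.

Lemma symb_lieM X S S' : symb_lie X (S * S') = symb_lie X S * S' + S * symb_lie X S'.
Proof.
have LM nu P mu Q : symb_lie X (gmono nu P * gmono mu Q) =
    symb_lie X (gmono nu P) * gmono mu Q + gmono nu P * symb_lie X (gmono mu Q).
  have gmM (a b : R) (p q : fpoly R N) :
    gmono a p * gmono b q = gmono (a + b) (p * q) :> symb R N by exact: gmul_mono.
  by rewrite gmM !symb_lie_gmono !gmM lieM raddfD.
have LMS nu P : symb_lie X (gmono nu P * S') =
    symb_lie X (gmono nu P) * S' + gmono nu P * symb_lie X S'.
  rewrite [S']galgE [in LHS]mulr_sumr [LHS]raddf_sum (raddf_sum (symb_lie X)).
  by rewrite !mulr_sumr -big_split; apply: eq_bigr => h _; exact: LM.
rewrite [S]galgE [in LHS]mulr_suml [LHS]raddf_sum (raddf_sum (symb_lie X)).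
by rewrite !mulr_suml -big_split; apply: eq_bigr => g _; exact: LMS.
Qed.

End LieDerivative.

(** * Affine contact vector fields *)

Section Pointwise.
Variables (R : realType) (N : nat).
Local Notation F := (Cinf R N).
Implicit Types (f g : F) (x : 'rV[R]_N) (X : vfield R N).

Lemma Cinf_ext f g : (forall x, f x = g x) -> f = g.
Proof. by move=> fg; apply: val_inj; apply/funext. Qed.

Definition evC x f : R := f x.
Fact evC_zmod x : zmod_morphism (evC x).
Proof. by []. Qed.
Fact evC_monoid x : monoid_morphism (evC x).
Proof. by []. Qed.
HB.instance Definition _ x := GRing.isZmodMorphism.Build F R (evC x) (evC_zmod x).
HB.instance Definition _ x := GRing.isMonoidMorphism.Build F R (evC x) (evC_monoid x).

(** An equation in the ring of smooth functions instead of a pointwise one, so that [dC] can be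
    applied to it. *)
Definition affine_by X (A : 'M[R]_N) (b : 'rV[R]_N) : Prop :=
  forall i, X i = \sum_j cstC N (A j i) * Defs.coord R j + cstC N (b 0 i).

Lemma affine_byP X A b :
  affine_by X A b <-> forall i x, X i x = (x *m A + b) 0 i.
Proof.
have E i x : (\sum_j cstC N (A j i) * Defs.coord R j + cstC N (b 0 i)) x =
    (x *m A + b) 0 i.
  rewrite -[LHS]/(evC x _) rmorphD rmorph_sum /= !mxE; congr (_ + _).
  apply: eq_bigr => j _; exact: mulrC.
split => [XE i x|XE i]; first by rewrite XE E.
by apply: Cinf_ext => x; rewrite E XE.
Qed.

Lemma dC_linear j (c : 'I_N -> R) d :
  dC j (\sum_i cstC N (c i) * Defs.coord R i + cstC N d) = cstC N (c j).
Proof.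
rewrite raddfD /= dC_cst addr0 raddf_sum (bigD1 j) //= dCM dC_cst mul0r add0r.
rewrite dC_coord eqxx mulr1 big1 ?addr0 // => i ij.
by rewrite dCM dC_cst mul0r add0r dC_coord (negPf ij) mulr0.
Qed.

Lemma dC_affine X A b : affine_by X A b -> forall i j, dC j (X i) = cstC N (A j i).
Proof. by move=> XE i j; rewrite XE dC_linear. Qed.

End Pointwise.

Section ContactAffine.
Variables (R : realType) (n : nat).
Local Notation N := (n + n + 1)%N.
Local Notation F := (Cinf R N).
Local Notation Y_ := (@Defs.Y R N).
Local Notation s_ := (@lshift (n + n) 1).
Implicit Types (X : vfield R N) (x b : 'rV[R]_N) (A : 'M[R]_N).

(** The coefficients of alpha at x form the row [2^-1 *: (x *m JN - e_t)], so the contact condition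
    for an affine field becomes a matrix identity. *)
Definition JN : 'M[R]_N := block_mx (sympJ n R) 0 0 0.
Definition e_t : 'rV[R]_N := row_mx 0 1%:M.

Lemma mul_JN (v : 'rV[R]_(n + n)) (t : 'M[R]_1) :
  row_mx v t *m JN = row_mx (v *m sympJ n R) 0.
Proof. by rewrite mul_row_block !mulmx0 !addr0. Qed.

Definition alphac (i : 'I_N) : F :=
  \sum_j cstC N (2^-1 * JN j i) * Defs.coord R j + cstC N (- 2^-1 * e_t 0 i).

Lemma alphacE i x : alphac i x = 2^-1 * (x *m JN - e_t) 0 i.
Proof.
have -> : (x *m JN - e_t) 0 i = (x *m JN) 0 i - e_t 0 i by rewrite [LHS]mxE [X in _ + X]mxE.
rewrite -[LHS]/(evC x _) rmorphD rmorph_sum mulrBr -mulNr /=; congr (_ + _).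
rewrite mxE mulr_sumr; apply: eq_bigr => j _.
by rewrite -[LHS]/(2^-1 * JN j i * x 0 j); ring.
Qed.

Lemma alphaE : alpha R n = \sum_i alphac i *: Y_ i.
Proof.
have xE x : x *m JN - e_t = row_mx (row_mx (- rsubmx (lsubmx x)) (lsubmx (lsubmx x))) (- 1%:M).
  rewrite -{1}[x]hsubmxK mul_JN opp_row_mx add_row_mx subr0 add0r -{1}[lsubmx x]hsubmxK.
  by rewrite mul_row_block !mulmx0 !mulmx1 add0r addr0 mulmxN mulmx1.
have c_p k : alphac (ip k) = - (cstC N 2^-1 * Defs.coord R (iq k)).
  apply: Cinf_ext => x; rewrite alphacE xE !row_mxEl !mxE mulrN.
  by rewrite -[RHS]/(- (2^-1 * x 0 (iq k))).
have c_q k : alphac (iq k) = cstC N 2^-1 * Defs.coord R (ip k).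
  apply: Cinf_ext => x; rewrite alphacE xE row_mxEl row_mxEr !mxE.
  by rewrite -[RHS]/(2^-1 * x 0 (ip k)).
have c_t : alphac (it n) = - cstC N 2^-1.
  apply: Cinf_ext => x; rewrite alphacE xE row_mxEr !mxE mulrN mulr1.
  by rewrite -[RHS]/(- 2^-1).
rewrite sum_phase big_split_ord /= c_t /alpha scalerBr scaleNr; congr (_ - _).
rewrite -big_split scaler_sumr; apply: eq_bigr => k _ /=.
by rewrite c_p c_q scaleNr scalerBr !scalerA [RHS]addrC.
Qed.

Lemma sum_Y_inj (g h : 'I_N -> F) :
  \sum_i g i *: Y_ i = \sum_i h i *: Y_ i -> g =1 h.
Proof.
move=> gh i; have := congr1 (mcoeff (mnm1 (Y_idx i))) gh.
have E (k : 'I_N -> F) : mcoeff (mnm1 (Y_idx i)) (\sum_j k j *: Y_ j) = k i.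
  rewrite raddf_sum (bigD1 i) //= mcoeffZ mcoeffX eqxx mulr1 big1 ?addr0 // => j ji.
  by rewrite mcoeffZ mcoeffX eq_mnm1 (inj_eq (@rshift_inj _ _)) (negPf ji) mulr0.
by rewrite !E.
Qed.

Lemma lie_alpha X A b : affine_by X A b -> lie_tensor X (alpha R n) =
  \sum_i (\sum_j X j * cstC N (2^-1 * JN j i)
          + \sum_m alphac m * cstC N (A i m)) *: Y_ i.
Proof.
move=> XE; rewrite alphaE raddf_sum /=.
under eq_bigr => i _ do rewrite lie_tensorZ lie_tensor_Y.
rewrite big_split /=.
have -> : \sum_i alphac i *: \sum_j dC j (X i) *: Y_ j =
    \sum_i (\sum_m alphac m * cstC N (A i m)) *: Y_ i.
  under eq_bigr => i _ do rewrite scaler_sumr.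
  rewrite exchange_big; apply: eq_bigr => j _ /=; rewrite scaler_suml.
  by apply: eq_bigr => i _; rewrite (dC_affine XE) scalerA.
rewrite -big_split; apply: eq_bigr => i _ /=; rewrite -scalerDl.
by congr ((_ + _) *: _); apply: eq_bigr => j _; rewrite dC_linear.
Qed.

Lemma lie_alpha_eq X A b f : affine_by X A b ->
  (lie_tensor X (alpha R n) = f *: alpha R n) <->
  forall x, (x *m A + b) *m JN + (x *m JN - e_t) *m A^T = f x *: (x *m JN - e_t).
Proof.
move=> XE; rewrite (lie_alpha XE).
have -> : f *: alpha R n = \sum_i (f * alphac i) *: Y_ i.
  by rewrite alphaE scaler_sumr; apply: eq_bigr => i _; rewrite scalerA.
have E i x : (\sum_j X j * cstC N (2^-1 * JN j i)
          + \sum_m alphac m * cstC N (A i m)) x =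
    2^-1 * ((x *m A + b) *m JN + (x *m JN - e_t) *m A^T) 0 i.
  rewrite -[LHS]/(evC x _) rmorphD !rmorph_sum /= [X in 2^-1 * X]mxE mulrDr.
  congr (_ + _); rewrite mxE mulr_sumr; apply: eq_bigr => j _.
    by rewrite -[LHS]/(X j x * (2^-1 * JN j i)) (affine_byP X A b).1 //; ring.
  by rewrite -[LHS]/(alphac j x * A i j) alphacE [A^T _ _]mxE mulrA.
have half : (2^-1 : R) != 0 by rewrite invr_neq0 // Num.Theory.pnatr_eq0.
split=> [/sum_Y_inj g x|g].
  apply/rowP => i; apply: (mulfI half); rewrite -E g.
  by rewrite -[LHS]/(f x * alphac i x) alphacE [in RHS]mxE mulrCA.
apply: eq_bigr => i _; congr (_ *: _); apply: Cinf_ext => x.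
by rewrite E g -[RHS]/(f x * alphac i x) alphacE [in LHS]mxE mulrCA.
Qed.

End ContactAffine.

(** * Normal form of the affine contact fields *)

Section AffineContactFields.
Variables (R : realType) (n : nat).
Local Notation N := (n + n + 1)%N.
Local Notation F := (Cinf R N).
Local Notation J := (sympJ n R).
Local Notation JN := (JN R n).
Local Notation e_t := (e_t R n).
Implicit Types (X : vfield R N) (x b : 'rV[R]_N) (A : 'M[R]_N) (c : R).
Implicit Types (As : 'M[R]_(n + n)) (bs : 'rV[R]_(n + n)).

(* The linear part of an affine contact field; the rows of matrices act on the right
   of row vectors, so the last column gives the component along d/dt. *)
Definition ac_mx As bs c : 'M[R]_N := block_mx As (bs *m J)^T 0 c%:M.

Lemma ac_mx_alpha As bs bt c X :
  affine_by X (ac_mx As bs c) (row_mx bs bt) -> As *m J + J *m As^T = c *: J ->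
  lie_tensor X (alpha R n) = cstC N c *: alpha R n.
Proof.
move=> XE AJ; apply/(lie_alpha_eq _ XE) => x.
rewrite -[cstC N c x]/c -[x]hsubmxK mul_row_block mulmx0 addr0 add_row_mx.
rewrite !mul_JN opp_row_mx add_row_mx subr0 sub0r /ac_mx tr_block_mx trmxK.
rewrite trmx0 mul_row_block mulmx0 add0r add_row_mx scale_row_mx.
rewrite mulNmx mul1mx mulmxDl addrACA addrN addr0 -!mulmxA -mulmxDr AJ.
by rewrite scalemxAr add0r tr_scalar_mx mulNmx mul1mx scalerN scalemx1.
Qed.

(** The point is that the multiplier [f] is constant. The component along t shows that f - f(0) is
    linear in x, and then f(x) times [x *m JN] would have a quadratic part, which the linearity of
    [x *m B] excludes. Comparing blocks then gives the shape of [A] and [b]. *)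
Lemma lie_alpha_blocks X A b f : affine_by X A b ->
  lie_tensor X (alpha R n) = f *: alpha R n ->
  exists As bs bt c, [/\ A = ac_mx As bs c, b = row_mx bs bt &
    As *m J + J *m As^T = c *: J].
Proof.
move=> XE /(lie_alpha_eq _ XE) fE; pose c := f 0.
have E0 : b *m JN - e_t *m A^T = - (c *: e_t).
  by have := fE 0; rewrite !mul0mx add0r sub0r mulNmx scalerN.
pose B := A *m JN + JN *m A^T.
have EB x : x *m B = f x *: (x *m JN) - (f x - c) *: e_t.
  have := fE x; rewrite mulmxDl mulmxBl addrACA E0 -!mulmxA -mulmxDr -/B => /eqP.
  by rewrite subr_eq => /eqP ->; rewrite scalerBr scalerBl opprB -[LHS]addrA [- _ + _]addrC.
pose l x := (x *m (JN *m A^T)) 0 (it n).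
have JN_t x : (x *m JN) 0 (it n) = 0.
  by rewrite -[x]hsubmxK mul_JN row_mxEr mxE.
have e_tt : e_t 0 (it n) = 1 by rewrite row_mxEr mxE eqxx.
have fl x : f x = c - l x.
  have := congr1 (fun y : 'rV_N => y 0 (it n)) (EB x).
  have entryD (u v : 'rV[R]_N) i : (u + v) 0 i = u 0 i + v 0 i by rewrite mxE.
  have entryN (u : 'rV[R]_N) i : (- u) 0 i = - u 0 i by rewrite mxE.
  have entryZ (a : R) (u : 'rV[R]_N) i : (a *: u) 0 i = a * u 0 i by rewrite mxE.
  rewrite /B mulmxDr (mulmxA x A) !entryD entryN !entryZ !JN_t e_tt /l; lra.
(* Comparison of the identity [EB] at [2 *: x] with twice the one at [x] isolates the quadratic
   part. *)
have lJ x : l x *: (x *m JN) = 0.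
  have l2 : l (2 *: x) = 2 * l x by rewrite /l -scalemxAl mxE.
  have := EB (2 *: x); rewrite !fl l2 -!scalemxAl EB fl => E2.
  by apply/rowP => i; have := congr1 (fun y : 'rV_N => y 0 i) E2; rewrite !mxE; nra.
have l0 x : l x = 0.
  (* Where [x *m JN] vanishes, so does [l x], by definition of [l]. *)
  have /eqP := lJ x; rewrite scaler_eq0 => /orP[/eqP //|/eqP xJ].
  by rewrite /l mulmxA xJ mul0mx mxE.
have BE : B = c *: JN.
  apply/row_matrixP => i; rewrite !rowE EB fl l0 subr0 subrr scale0r subr0.
  by rewrite scalemxAr.
have bE : b *m JN - e_t *m A^T = row_mx (lsubmx b *m J - (ursubmx A)^T) (- (drsubmx A)^T).
  rewrite -{1}[b]hsubmxK mul_JN -{1}[A]submxK tr_block_mx mul_row_block.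
  by rewrite !mul0mx !add0r !mul1mx opp_row_mx add_row_mx sub0r.
have BJ : B = block_mx (ulsubmx A *m J + J *m (ulsubmx A)^T) (J *m (dlsubmx A)^T)
    (dlsubmx A *m J) 0.
  rewrite /B -{1 2}[A]submxK tr_block_mx !mulmx_block !mulmx0 !mul0mx.
  by rewrite !addr0 add_block_mx add0r !addr0.
move: BE; rewrite BJ scale_block_mx !scaler0 => /eq_block_mx[AJ _ rJ _].
move: E0; rewrite bE scale_row_mx opp_row_mx scaler0 oppr0 scalemx1.
move=> /eq_row_mx[/eqP]; rewrite subr_eq0 => /eqP bJ /oppr_inj dc.
exists (ulsubmx A), (lsubmx b), (rsubmx b 0 0)%:M, c; split => //.
- rewrite -{1}[A]submxK /ac_mx bJ trmxK -[drsubmx A]trmxK dc tr_scalar_mx.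
  have -> // : dlsubmx A = 0.
  have -> : dlsubmx A = - (dlsubmx A *m J *m J).
    by rewrite -mulmxA sympJ_sqr mulmxN mulmx1 opprK.
  by rewrite rJ mul0mx oppr0.
- by rewrite -mx11_scalar hsubmxK.
Qed.

End AffineContactFields.

(** * Invariance of the generators *)

Section Dot.
Variables (K : comNzRingType) (m : nat).
Implicit Types (u v w : 'rV[K]_m) (a : K) (A : 'M[K]_m).

Definition dot u v : K := (u *m v^T) 0 0.

Lemma dotE u v : dot u v = \sum_i u 0 i * v 0 i.
Proof. by rewrite /dot mxE; apply: eq_bigr => i _; rewrite [_^T _ _]mxE. Qed.
Lemma dotC u v : dot u v = dot v u.
Proof. by rewrite !dotE; apply: eq_bigr => i _; rewrite mulrC. Qed.
Lemma dotDl u v w : dot (u + v) w = dot u w + dot v w.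
Proof. by rewrite /dot mulmxDl mxE. Qed.
Lemma dotDr u v w : dot u (v + w) = dot u v + dot u w.
Proof. by rewrite !(dotC u) dotDl. Qed.
Lemma dotZl a u v : dot (a *: u) v = a * dot u v.
Proof. by rewrite /dot -scalemxAl mxE. Qed.
Lemma dotZr a u v : dot u (a *: v) = a * dot u v.
Proof. by rewrite !(dotC u) dotZl. Qed.
Lemma dotNr u v : dot u (- v) = - dot u v.
Proof. by rewrite -scaleN1r dotZr mulN1r. Qed.
Lemma dotNl u v : dot (- u) v = - dot u v.
Proof. by rewrite !(dotC _ v) dotNr. Qed.
Lemma dot_trmx u v A : dot u (v *m A^T) = dot (u *m A) v.
Proof. by rewrite /dot trmx_mul trmxK mulmxA. Qed.

End Dot.

(** Here [v], [w] stand for xi_s, eta_s, and [dv], [dw] for their Lie derivatives. The terms in [b]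
    coming from [dv] and [dw] are cancelled by those coming from the derivative of [x], which is
    what the Euler terms of [L1] are for; the conformal relation for [A] leaves the factor - c. *)
Lemma L1_identity (K : comNzRingType) n (x v w b : 'rV[K]_(n + n))
    (A : 'M[K]_(n + n)) (vt wt c : K) (J := sympJ n K)
    (dv := - (v *m A^T) - vt *: (b *m J)) (dw := - (w *m A^T) - wt *: (b *m J)) :
  A^T *m J + J *m A = c *: J ->
  dot (dv *m J) w + dot (v *m J) dw
  + (- (c * wt) * dot x v + wt * (dot (x *m A + b) v + dot x dv))
  - (- (c * vt) * dot x w + vt * (dot (x *m A + b) w + dot x dw))
  = - (c * (dot (v *m J) w + wt * dot x v - vt * dot x w)).
Proof.
move=> AJ.
have bJJ : b *m J *m J = - b by rewrite -mulmxA sympJ_sqr mulmxN mulmx1.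
have -> : dot (dv *m J) w = - dot (v *m A^T *m J) w + vt * dot b w.
  by rewrite /dv mulmxBl mulNmx -scalemxAl bJJ scalerN opprK dotDl dotZl dotNl.
have -> : dot (v *m J) dw = - dot (v *m J *m A) w - wt * dot v b.
  rewrite /dw dotDr !dotNr dotZr dot_trmx; congr (- _ - _ * _).
  rewrite /dot trmx_mul tr_sympJ mulNmx mulmxN !mulmxA -(mulmxA v) sympJ_sqr.
  by rewrite mulmxN mulmx1 mulNmx opprK.
have -> : dot (v *m A^T *m J) w = c * dot (v *m J) w - dot (v *m J *m A) w.
  rewrite -mulmxA -[A^T *m J](addrK (J *m A)) AJ mulmxBr -scalemxAr mulmxA.
  by rewrite dotDl dotNl dotZl.
rewrite /dv /dw !dotDl !dotDr !dotNr !dotZr !dot_trmx (dotC v b).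
ring.
Qed.

Section GeneratorInvariance.
Variables (R : realType) (n : nat).
Local Notation N := (n + n + 1)%N.
Local Notation F := (Cinf R N).
Local Notation P := (fpoly R N).
Local Notation s_ := (@lshift (n + n) 1).
Local Notation J := (sympJ n).
Local Notation x_ := (@Defs.coord R N).
Local Notation xi_ := (@Defs.xi R N).
Local Notation eta_ := (@Defs.eta R N).
Local Notation Y_ := (@Defs.Y R N).
Implicit Types (X : vfield R N) (zeta : 'I_N -> P).

Definition scal : R -> P := mpolyC (N + N + N) (R := F) \o cstC N (R := R).
HB.instance Definition _ := GRing.RMorphism.on scal.

Definition s_row (v : 'I_N -> P) : 'rV[P]_(n + n) := \row_i v (s_ i).

Lemma eulerE (zeta : 'I_N -> P) :
  euler zeta = dot (s_row (fun i => mpolyC _ (x_ i))) (s_row zeta).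
Proof.
rewrite dotE big_split_ord /= -big_split /euler; apply: eq_bigr => k _ /=.
by rewrite !mxE !mul_mpolyC.
Qed.

Definition covariant X (zeta : 'I_N -> P) : Prop :=
  forall j, lie_tensor X (zeta j) = - \sum_i dC j (X i) *: zeta i.

Lemma lie_pairing X zeta : covariant X zeta ->
  lie_tensor X (\sum_i Y_ i * zeta i) = 0.
Proof.
move=> zetaP; rewrite raddf_sum /=.
under eq_bigr => i _ do rewrite lie_tensorM lie_tensor_Y zetaP mulrN.
rewrite sumrB; apply/eqP; rewrite subr_eq0; apply/eqP.
under eq_bigr => i _ do rewrite mulr_suml.
rewrite exchange_big; apply: eq_bigr => i _ /=; rewrite mulr_sumr.
by apply: eq_bigr => j _; rewrite -scalerAl -scalerAr.
Qed.

Section Blocks.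
Variables (X : vfield R N) (As : 'M[R]_(n + n)) (bs : 'rV[R]_(n + n)).
Variables (bt : 'M[R]_1) (c : R).
Hypothesis XE : affine_by X (ac_mx As bs c) (row_mx bs bt).
Hypothesis AJ : As *m J R + J R *m As^T = c *: J R.

(** Multiplication of [AJ] by [J] on both sides; covectors transform by the transposed matrix. *)
Lemma AJ_tr : As^T *m J R + J R *m As = c *: J R.
Proof.
have := congr1 (fun B => - (J R *m B *m J R)) AJ.
rewrite mulmxDr mulmxDl -scalemxAr -scalemxAl !mulmxA sympJ_sqr mulNmx mul1mx.
rewrite -[J R *m As *m _ *m _]mulmxA sympJ_sqr mulmxN mulmx1 mulNmx.
by rewrite opprD !opprK mulNmx mul1mx scalerN opprK addrC.
Qed.

Lemma ac_trace : \tr As = n%:R * c.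
Proof.
have JJ (B : 'M[R]_(n + n)) : \tr (B *m J R *m J R) = - \tr B.
  by rewrite -mulmxA sympJ_sqr mulmxN mulmx1 raddfN.
have := congr1 (fun B => \tr (B *m J R)) AJ.
rewrite mulmxDl raddfD /= JJ -scalemxAl sympJ_sqr linearZ /= raddfN /= mxtrace1.
rewrite -mulmxA mxtrace_mulC JJ mxtrace_tr natrD; lra.
Qed.

Lemma ac_divergence : divergence X = cstC N (n.+1%:R * c).
Proof.
rewrite /divergence; under eq_bigr => i _ do rewrite (dC_affine XE).
rewrite -rmorph_sum -/(\tr _) mxtrace_block ac_trace mxtrace_scalar.
by congr (cstC N _); rewrite -natr1 mulrDl mul1r mulr1n.
Qed.

(** The origin of the weight 1 / (n + 1): the divergence is n + 1 times the conformal factor c, so a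
    density of this weight is scaled by c and compensates a polynomial scaled by - c. *)
Lemma ac_wI : cstC N (wI R n) * divergence X = cstC N c.
Proof.
by rewrite ac_divergence -rmorphM /wI mulrA mulVf ?mul1r.
Qed.

Lemma lie_cov_t zeta : covariant X zeta ->
  lie_tensor X (zeta (it n)) = - (scal c * zeta (it n)).
Proof.
move=> zetaP; rewrite zetaP; congr (- _).
rewrite sum_phase big1 => [|i _]; last first.
  by rewrite (dC_affine XE) block_mxEdl mxE rmorph0 scale0r.
by rewrite (dC_affine XE) block_mxEdr mxE add0r mulr1n -mul_mpolyC.
Qed.

Lemma lie_cov_s zeta : covariant X zeta ->
  map_mx (lie_tensor X) (s_row zeta) =
  - (s_row zeta *m (map_mx scal As)^T) - zeta (it n) *: map_mx scal (bs *m J R).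
Proof.
move=> zetaP; apply/rowP => a; rewrite mxE mxE zetaP sum_phase opprD.
under eq_bigr => i _ do rewrite (dC_affine XE) block_mxEul.
rewrite (dC_affine XE) block_mxEur [(bs *m J R)^T _ _]mxE.
rewrite [RHS]mxE [X in _ = X + _]mxE [X in _ = - X + _]mxE; congr (- _ + _).
  by apply: eq_bigr => i _; rewrite !mxE -mul_mpolyC mulrC.
rewrite [RHS]mxE [X in _ = - X]mxE [X in _ = - (_ * X)]mxE -mul_mpolyC mulrC.
by rewrite (_ : ord0 = 0).
Qed.

Lemma lie_xs : map_mx (lie_tensor X) (s_row (fun i => mpolyC _ (x_ i))) =
  s_row (fun i => mpolyC _ (x_ i)) *m map_mx scal As + map_mx scal bs.
Proof.
apply/rowP => a; rewrite mxE mxE lie_tensorC.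
rewrite (bigD1 (s_ a)) //= dC_coord eqxx mulr1 big1 ?addr0 => [|i ia]; last first.
  by rewrite dC_coord eq_sym (negPf ia) mulr0.
rewrite XE sum_phase block_mxEdl [const_mx _ _ _]mxE rmorph0 mul0r addr0.
rewrite row_mxEl rmorphD rmorph_sum /=.
rewrite [RHS]mxE [X in _ = X + _]mxE [X in _ = _ + X]mxE; congr (_ + _).
apply: eq_bigr => i _; rewrite block_mxEul !mxE rmorphM mulrC //.
Qed.


Lemma lie_dot m (u v : 'rV[P]_m) : lie_tensor X (dot u v) =
  dot (map_mx (lie_tensor X) u) v + dot u (map_mx (lie_tensor X) v).
Proof.
rewrite !dotE raddf_sum -big_split; apply: eq_bigr => i _ /=.
rewrite lie_tensorM.
by congr (_ * _ + _ * _); rewrite mxE.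
Qed.

Lemma lie_scal a : lie_tensor X (scal a) = 0.
Proof.
rewrite /scal /= lie_tensorC big1 ?mpolyC0 // => i _.
by rewrite dC_cst mulr0.
Qed.

Lemma lie_mul_scal m p (u : 'rV[P]_m) (B : 'M[R]_(m, p)) :
  map_mx (lie_tensor X) (u *m map_mx scal B) =
  map_mx (lie_tensor X) u *m map_mx scal B.
Proof.
apply/rowP => i; rewrite [LHS]mxE [in LHS]mxE [RHS]mxE raddf_sum; apply: eq_bigr => j _ /=.
rewrite lie_tensorM.
have -> : lie_tensor X (map_mx scal B j i) = 0 by rewrite mxE lie_scal.
by rewrite mulr0 addr0; congr (_ * _); rewrite mxE.
Qed.

Definition pairing_L1 : P :=
  \sum_k (xi_ (ip k) * eta_ (iq k) - xi_ (iq k) * eta_ (ip k))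
   + eta_ (it n) * euler xi_ - xi_ (it n) * euler eta_.

Lemma lie_L1 : lie_tensor X pairing_L1 = - (scal c * pairing_L1).
Proof.
have xiP : covariant X xi_ by move=> j; exact: lie_tensor_xi.
have etaP : covariant X eta_ by move=> j; exact: lie_tensor_eta.
rewrite /pairing_L1 !eulerE.
have -> : \sum_k (xi_ (ip k) * eta_ (iq k) - xi_ (iq k) * eta_ (ip k)) =
    dot (s_row xi_ *m map_mx scal (J R)) (s_row eta_).
  rewrite map_sympJ [RHS]sympE; apply: eq_bigr => k _.
  by congr (_ * _ - _ * _); rewrite mxE.
pose x := s_row (fun i => mpolyC _ (x_ i)); rewrite -/x.
have key a d1 d2 b d3 a' d1' d2' b' d3' :
    lie_tensor X d1 = d1' -> lie_tensor X a = a' -> lie_tensor X d2 = d2' ->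
    lie_tensor X b = b' -> lie_tensor X d3 = d3' ->
    lie_tensor X (d1 + a * d2 - b * d3) = d1' + (a' * d2 + a * d2') - (b' * d3 + b * d3').
  by move=> <- <- <- <- <-; rewrite -!lie_tensorM raddfB raddfD.
pose dxi := - (s_row xi_ *m (map_mx scal As)^T) - xi_ (it n) *: (map_mx scal bs *m J P).
pose deta := - (s_row eta_ *m (map_mx scal As)^T) - eta_ (it n) *: (map_mx scal bs *m J P).
pose dx := x *m map_mx scal As + map_mx scal bs.
have exi : map_mx (lie_tensor X) (s_row xi_) = dxi.
  rewrite (lie_cov_s xiP) map_mxM map_sympJ; reflexivity.
have eeta : map_mx (lie_tensor X) (s_row eta_) = deta.
  rewrite (lie_cov_s etaP) map_mxM map_sympJ; reflexivity.
have ex : map_mx (lie_tensor X) x = dx := lie_xs.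
have e1 : lie_tensor X (dot (s_row xi_ *m map_mx scal (J R)) (s_row eta_)) =
    dot (dxi *m J P) (s_row eta_) + dot (s_row xi_ *m J P) deta.
  rewrite lie_dot lie_mul_scal exi eeta map_sympJ; reflexivity.
have e2 : lie_tensor X (dot x (s_row xi_)) = dot dx (s_row xi_) + dot x dxi.
  rewrite lie_dot exi ex; reflexivity.
have e3 : lie_tensor X (dot x (s_row eta_)) = dot dx (s_row eta_) + dot x deta.
  rewrite lie_dot eeta ex; reflexivity.
rewrite (key _ _ _ _ _ _ _ _ _ _ e1 (lie_cov_t etaP) e2 (lie_cov_t xiP) e3).
rewrite map_sympJ; apply: L1_identity.
rewrite map_trmx -(map_sympJ n scal) -!map_mxM -map_mxD AJ_tr map_mxZ; reflexivity.
Qed.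

End Blocks.
End GeneratorInvariance.

(** * The algebra of invariants contains the generators *)

Section Invariants.
Variables (R : realType) (n : nat).
Local Notation N := (n + n + 1)%N.
Local Notation J := (sympJ n R).
Implicit Types (X : vfield R N) (S : symb R N).

(** The conformal factor is an explicit argument because it determines the divergence, hence the
    action on densities. *)
Definition ac_field X (c : R) : Prop := exists (As : 'M[R]_(n + n)) bs (bt : 'M[R]_1),
  affine_by X (ac_mx As bs c) (row_mx bs bt) /\ As *m J + J *m As^T = c *: J.

Lemma ac_fieldP X : affine X /\ contact X <-> exists c, ac_field X c.
Proof.
split.
  move=> [[A [b XE]] [f fE]]; rewrite lie0E in fE.
  have [As [bs [bt [c [AE bE AJ]]]]] := lie_alpha_blocks ((affine_byP X A b).2 XE) fE.
  by exists c, As, bs, bt; rewrite -AE -bE; split; first exact/affine_byP.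
move=> [c [As [bs [bt [XE AJ]]]]]; split.
  by exists (ac_mx As bs c), (row_mx bs bt); exact/affine_byP.
by exists (cstC N c); rewrite lie0E (ac_mx_alpha XE AJ).
Qed.

Lemma AC_invariantP S :
  AC_invariant S <-> forall X c, ac_field X c -> forall nu, lie nu X (gcoef nu S) = 0.
Proof.
split=> [inv X c Xc nu|inv X Xa Xc].
  have [Xa Xct] : affine X /\ contact X by apply/ac_fieldP; exists c.
  by rewrite -gcoef_symb_lie inv // raddf0.
have [c Xc'] : exists c, ac_field X c by exact/ac_fieldP.
by apply/galgP => nu; rewrite gcoef_symb_lie (inv X c) // raddf0.
Qed.

Lemma AC_invariant_gmono nu (Q : fpoly R N) :
  (forall X c, ac_field X c -> lie nu X Q = 0) -> AC_invariant (gmono nu Q).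
Proof.
move=> inv X Xa Xc; have [c Xc'] : exists c, ac_field X c by exact/ac_fieldP.
by rewrite symb_lie_gmono (inv X c) // raddf0.
Qed.

Lemma AC_invariantM S S' : AC_invariant S -> AC_invariant S' -> AC_invariant (S * S').
Proof.
move=> inv inv' X Xa Xc; rewrite symb_lieM inv // inv' //.
by rewrite mul0r mulr0 addr0.
Qed.

Lemma AC_invariantD S S' : AC_invariant S -> AC_invariant S' -> AC_invariant (S + S').
Proof.
by move=> inv inv' X Xa Xc; rewrite raddfD /= inv // inv' // addr0.
Qed.

Lemma AC_invariantC (a : R) : AC_invariant (symbC N a).
Proof.
move=> X _ _; rewrite /symbC symb_lie_gmono lie0E -mul_mpolyC mulr1 lie_tensorC.
rewrite big1 ?mpolyC0 ?raddf0 // => i _.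
by rewrite dC_cst mulr0.
Qed.

Lemma AC_invariantZ a S : AC_invariant S -> AC_invariant (a *: S).
Proof. by move=> inv; apply: AC_invariantM => //; exact: AC_invariantC. Qed.

Lemma AC_invariant_u1 : AC_invariant (u1 R n).
Proof.
apply: AC_invariant_gmono => X c _; rewrite lie0E; apply: lie_pairing.
by move=> j; exact: lie_tensor_xi.
Qed.

Lemma AC_invariant_u2 : AC_invariant (u2 R n).
Proof.
apply: AC_invariant_gmono => X c _; rewrite lie0E; apply: lie_pairing.
by move=> j; exact: lie_tensor_eta.
Qed.

Lemma AC_invariant_u3 : AC_invariant (u3 R n).
Proof.
apply: AC_invariant_gmono => X c [As [bs [bt [XE AJ]]]].
rewrite lieE (ac_mx_alpha XE AJ) rmorphN mulNr (ac_wI XE AJ) scaleNr.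
by rewrite subrr.
Qed.

Lemma lie_wI X c (Q : fpoly R N) : ac_field X c ->
  lie_tensor X Q = - (scal n c * Q) -> lie (wI R n) X Q = 0.
Proof.
move=> [As [bs [bt [XE AJ]]]] XQ.
by rewrite lieE XQ (ac_wI XE AJ) -mul_mpolyC addNr.
Qed.

Lemma AC_invariant_cov (zeta : 'I_N -> fpoly R N) :
  (forall X, covariant X zeta) -> AC_invariant (gmono (wI R n) (- 2 * zeta (it n))).
Proof.
move=> zetaP; apply: AC_invariant_gmono => X c Xc; apply: (lie_wI Xc).
have [As [bs [bt [XE AJ]]]] := Xc.
have E := lie_cov_t XE (zetaP X).
rewrite mulNr mulr_natl raddfN raddfMn /= E mulNrn opprK mulrN opprK.
by rewrite mulrnAr.
Qed.

Lemma AC_invariant_u4 : AC_invariant (u4 R n).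
Proof. by apply: (AC_invariant_cov (zeta := @Defs.xi R N)) => X j; exact: lie_tensor_xi. Qed.

Lemma AC_invariant_u5 : AC_invariant (u5 R n).
Proof. by apply: (AC_invariant_cov (zeta := @Defs.eta R N)) => X j; exact: lie_tensor_eta. Qed.

Lemma AC_invariant_L1 : AC_invariant (L1 R n).
Proof.
apply: AC_invariant_gmono => X c Xc; apply: (lie_wI Xc).
by have [As [bs [bt [XE AJ]]]] := Xc; exact: (lie_L1 XE AJ).
Qed.

End Invariants.

(** * Invariants are determined by their value at the origin *)

(* One coordinate at a time, so that only partial derivatives are needed. *)
Lemma dC_eq0_const (R : realType) (N : nat) (f : Cinf R N) :
  (forall i, dC i f = 0) -> forall x, f x = f 0.
Proof.
move=> df0; have line i y (c : R) : f (y + c *: 'e_i) = f y.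
  pose g (s : R) : R := f (y + s *: 'e_i).
  have g' (s : R) : is_derive s 1 g 0.
    have fd : derivable f (y + s *: 'e_i) 'e_i by exact: Cinf_derivable.
    have gE : (fun h : R => h^-1 *: ((g \o shift s) (h *: (1 : R)) - g s)) =
        (fun h : R => h^-1 *: ((f \o shift (y + s *: 'e_i)) (h *: 'e_i) - f (y + s *: 'e_i))).
      apply/funext => h /=; rewrite /g; congr (_ *: (f _ - _)).
      have h1 : h *: (1 : R) = h := mulr1 h.
      rewrite h1 scalerDl addrCA; reflexivity.
    have gd : derivable g s 1 by rewrite /derivable gE.
    apply: DeriveDef => //; rewrite /derive gE.
    by have := congr1 (fun h : Cinf R N => h (y + s *: 'e_i)) (df0 i).
  have gc : g c = g 0 by exact: is_derive_0_is_cst.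
  by rewrite -[LHS]/(g c) gc /g scale0r addr0.
move=> x; have sumE (s : seq 'I_N) y : f (y + \sum_(i <- s) x 0 i *: 'e_i) = f y.
  elim: s y => [|i s IH] y; first by rewrite big_nil addr0.
  by rewrite big_cons addrA IH line.
by rewrite [x in LHS]row_sum_delta -[X in f X]add0r sumE.
Qed.

Section Multidegree.
Variables (K : comNzRingType) (m : nat).
Implicit Types (Q : mpoly m K) (d : multinom m) (w : 'I_m -> nat).

Lemma mcoeff_var_mderiv i j d Q :
  (forall d', d = mnm_add (mnm1 i) d' -> mcoeff (mnm_add d' (mnm1 j)) Q = 0) ->
  mcoeff d (var i * mderiv j Q) = 0.
Proof.
move=> Q0; rewrite mcoeffM big1 // => k /eqP dk; rewrite mcoeffX.
case: eqP => [ik|_]; last by rewrite mul0r.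
by rewrite mcoeff_mderiv Q0 ?mul0rn ?mulr0 // ik.
Qed.

Lemma mcoeff_euler i d Q : mcoeff d (var i * mderiv i Q) = mcoeff d Q *+ d i.
Proof.
case: (posnP (d i)) => [di|di].
  rewrite di mulr0n mcoeff_var_mderiv // => d' dE.
  by move: di; rewrite dE mnmDE mnm1E eqxx.
have dE : d = mnm_add (mnm1 i) (mnm_sub d (mnm1 i)).
  by rewrite addmC submK // lep1mP -lt0n.
rewrite {1}dE mulrC mcoeffMX mcoeff_mderiv addmC -dE mnmBE mnm1E eqxx.
by rewrite subn1 prednK.
Qed.

Definition mweight w d := (\sum_i w i * d i)%N.

Lemma mweightD w d d' : mweight w (mnm_add d d') = (mweight w d + mweight w d')%N.
Proof.
by rewrite -big_split; apply: eq_bigr => i _; rewrite mnmDE mulnDr.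
Qed.

Lemma mweight1 w i : mweight w (mnm1 i) = w i.
Proof.
rewrite /mweight (bigD1 i) //= mnm1E eqxx muln1 big1 ?addn0 // => j ji.
by rewrite mnm1E eq_sym (negPf ji) muln0.
Qed.

Lemma mweight_le w d : (forall i, w i <= 1)%N -> (mweight w d <= mdeg d)%N.
Proof.
by move=> w1; rewrite mdegE; apply: leq_sum => i _; rewrite -[leqRHS]mul1n leq_mul.
Qed.

End Multidegree.

Section Origin.
Variables (R : realType) (n : nat).
Local Notation N := (n + n + 1)%N.
Local Notation M := (N + N + N)%N.
Local Notation F := (Cinf R N).
Local Notation J := (sympJ n R).
Local Notation s_ := (@lshift (n + n) 1).
Local Notation xi_ := (@Defs.xi R N).
Local Notation eta_ := (@Defs.eta R N).
Local Notation Y_ := (@Defs.Y R N).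
Implicit Types (X : vfield R N) (Q : fpoly R N) (d : multinom M).

Definition field_of (A : 'M[R]_N) (b : 'rV[R]_N) : vfield R N :=
  fun i => \sum_j cstC N (A j i) * Defs.coord R j + cstC N (b 0 i).

Lemma field_of_ac (As : 'M[R]_(n + n)) bs (bt : 'M[R]_1) c :
  As *m J + J *m As^T = c *: J -> ac_field (field_of (ac_mx As bs c) (row_mx bs bt)) c.
Proof. by move=> AJ; exists As, bs, bt. Qed.

(** The action of the elementary linear field x_j d/dx_i on the fibre variables. *)
Definition vertical (i j : 'I_N) Q : fpoly R N :=
  Y_ j * dfvar (Y_idx i) Q - xi_ i * dfvar (xi_idx j) Q - eta_ i * dfvar (eta_idx j) Q.

Lemma lie_tensor_affine X A b Q : affine_by X A b ->
  lie_tensor X Q = \sum_i X i *: dcoef i Q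
                   + \sum_i \sum_j cstC N (A j i) *: vertical i j Q.
Proof.
move=> XE; have key (p q r t : fpoly R N) : p - q - r + t = p + (t - r - q) by ring.
rewrite /lie_tensor key; congr (_ + _).
rewrite -sumrB -sumrB; apply: eq_bigr => i _.
rewrite -sumrB -sumrB; apply: eq_bigr => j _.
rewrite -scalerBr -scalerBr (dC_affine XE); reflexivity.
Qed.

(* [vertical (it n) (s_ a)] lowers this weight by 1. *)
Definition low_weight : 'I_M -> nat :=
  fpoint (row_mx (const_mx 1) (const_mx 0)) (row_mx (const_mx 1) (const_mx 0))
         (row_mx (const_mx 0) (const_mx 1)).

Lemma mcoeff_vertical_t a Q d :
  (forall d', mweight low_weight d' = (mweight low_weight d).+1 -> mcoeff d' Q = 0) ->
  mcoeff d (vertical (it n) (s_ a) Q) = 0.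
Proof.
move=> Q0; have step i j : low_weight j = (low_weight i).+1 ->
    mcoeff d (var i * mderiv j Q) = 0.
  move=> ij; apply: mcoeff_var_mderiv => d' dE; apply: Q0.
  by rewrite dE !mweightD !mweight1 ij addnS addnC.
have eY : mcoeff d (Y_ (s_ a) * dfvar (Y_idx (it n)) Q) = 0.
  by apply: step; rewrite /low_weight !fpointE row_mxEl row_mxEr !mxE.
have ex : mcoeff d (xi_ (it n) * dfvar (xi_idx (s_ a)) Q) = 0.
  by apply: step; rewrite /low_weight !fpointE row_mxEl row_mxEr !mxE.
have ee : mcoeff d (eta_ (it n) * dfvar (eta_idx (s_ a)) Q) = 0.
  by apply: step; rewrite /low_weight !fpointE row_mxEl row_mxEr !mxE.
have key (p q r : fpoly R N) : mcoeff d p = 0 -> mcoeff d q = 0 -> mcoeff d r = 0 ->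
    mcoeff d (p - q - r) = 0 by rewrite !mcoeffB => -> -> ->; rewrite !subr0.
exact: key.
Qed.

(** These fields form a Heisenberg algebra whose values span every tangent space. Their divergence
    is 0, so the density weight does not enter. *)
Lemma mcoeff_lie_heis (bs : 'rV[R]_(n + n)) (bt : 'M[R]_1) Q d
    (X := field_of (ac_mx 0 bs 0) (row_mx bs bt)) :
  mcoeff d (lie_tensor X Q) = \sum_a cstC N (bs 0 a) * dC (s_ a) (mcoeff d Q)
    + X (it n) * dC (it n) (mcoeff d Q)
    + \sum_a cstC N ((bs *m J) 0 a) * mcoeff d (vertical (it n) (s_ a) Q).
Proof.
have XE : affine_by X (ac_mx 0 bs 0) (row_mx bs bt) by [].
have Xs a : X (s_ a) = cstC N (bs 0 a).
  rewrite XE row_mxEl sum_phase block_mxEdl [const_mx _ _ _]mxE rmorph0 mul0r addr0.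
  by rewrite big1 ?add0r // => i _; rewrite block_mxEul mxE rmorph0 mul0r.
rewrite (lie_tensor_affine _ XE) mcoeffD; congr (_ + _).
  rewrite raddf_sum sum_phase; congr (_ + _); last first.
    by rewrite /= mcoeffZ /dcoef mcoeff_map_mpoly.
  by apply: eq_bigr => a _ /=; rewrite mcoeffZ /dcoef mcoeff_map_mpoly Xs.
rewrite raddf_sum sum_phase big1 ?add0r => [|i _]; last first.
  rewrite big1 ?raddf0 // => j _; case: (split_ordP j) => k ->.
    by rewrite block_mxEul mxE rmorph0 scale0r.
  by rewrite block_mxEdl mxE rmorph0 scale0r.
rewrite /= sum_phase mcoeffD block_mxEdr mxE mul0rn rmorph0 scale0r mcoeff0 addr0.
rewrite raddf_sum; apply: eq_bigr => a _.
by rewrite /= mcoeffZ block_mxEur [_^T _ _]mxE.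
Qed.

Lemma invariant_eq0 nu Q :
  (forall X c, ac_field X c -> lie nu X Q = 0) ->
  (forall d, (mcoeff d Q : F) 0 = 0) -> Q = 0.
Proof.
move=> inv Q0.
have heis (bs : 'rV[R]_(n + n)) (bt : 'M[R]_1) (b := row_mx bs bt) :
    lie_tensor (field_of (ac_mx 0 bs 0) b) Q = 0.
  have AJ : (0 : 'M[R]_(n + n)) *m J + J *m 0^T = 0 *: J.
    by rewrite trmx0 mul0mx mulmx0 addr0 scale0r.
  have := inv _ _ (field_of_ac bs bt AJ); rewrite lieE.
  rewrite (ac_divergence (bt := bt) (As := 0) (bs := bs) (c := 0)) //.
  by rewrite mulr0 rmorph0 mulr0 scale0r addr0.
(* The field d/dt has constant coefficients, so it only differentiates. Settling it beforehand
   removes the nonconstant factor [X (it n)] from the other equations. *)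
have dtQ d : dC (it n) (mcoeff d Q) = 0.
  have := congr1 (mcoeff d) (heis 0 1%:M); rewrite mcoeff_lie_heis mcoeff0.
  rewrite big1 ?add0r => [|a _]; last by rewrite mxE rmorph0 mul0r.
  rewrite [X in _ + X]big1 ?addr0 => [|a _]; last by rewrite mul0mx mxE rmorph0 mul0r.
  suff -> : field_of (ac_mx 0 0 0) (row_mx 0 1%:M) (it n) = 1 by rewrite mul1r.
  rewrite /field_of row_mxEr mxE eqxx rmorph1 big1 ?add0r // => i _.
  case: (split_ordP i) => k ->; last by rewrite block_mxEdr mxE mul0rn rmorph0 mul0r.
  by rewrite block_mxEur mul0mx !mxE rmorph0 mul0r.
(* Descending induction on the weight of [d], started beyond the degree of [Q], where all
   coefficients are 0. *)
suff Q00 k d : (msize Q <= k + mweight low_weight d)%N -> mcoeff d Q = 0.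
  by apply/mpolyP => d; rewrite mcoeff0 (Q00 (msize Q)) // leq_addr.
elim: k d => [|k IH] d le_kd.
  apply/eqP; rewrite mcoeff_eq0; apply: contraL le_kd => /msize_mdeg_lt dQ.
  rewrite add0n -ltnNge (leq_ltn_trans _ dQ) // mweight_le //.
  by elim/fvarP => i; rewrite /low_weight !fpointE;
     case: (split_ordP i) => j ->; rewrite ?row_mxEl ?row_mxEr !mxE.
suff dQ i : dC i (mcoeff d Q) = 0.
  by apply: Cinf_ext => x; rewrite (dC_eq0_const dQ) Q0.
case: (split_ordP i) => j ->; last first.
  by rewrite ord1 dtQ.
have := congr1 (mcoeff d) (heis (delta_mx 0 j) 0).
rewrite mcoeff_lie_heis mcoeff0 dtQ mulr0 addr0.
rewrite [X in _ + X]big1 ?addr0 => [|a _]; last first.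
  rewrite mcoeff_vertical_t ?mulr0 // => d' d'd; apply: IH.
  by rewrite d'd -(addSnnS k).
rewrite (bigD1 j) //= mxE !eqxx rmorph1 mul1r big1 ?addr0 // => a aj.
by rewrite mxE (negPf aj) andbF rmorph0 mul0r.
Qed.

End Origin.

(** * Values at the origin *)

Section ValueAtOrigin.
Variables (R : realType) (n : nat).
Local Notation N := (n + n + 1)%N.
Local Notation M := (N + N + N)%N.
Local Notation F := (Cinf R N).
Local Notation J := (sympJ n R).
Local Notation s_ := (@lshift (n + n) 1).
Implicit Types (X : vfield R N) (Q : fpoly R N) (S T : symb R N) (d : multinom M).
Implicit Types (P : mpoly M R).

Definition value0 Q : mpoly M R := map_mpoly (evC 0) Q.

Lemma mcoeff_value0 d Q : mcoeff d (value0 Q) = (mcoeff d Q : F) 0.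
Proof. exact: mcoeff_map_mpoly. Qed.

Lemma value0B Q Q' : value0 (Q - Q') = value0 Q - value0 Q'.
Proof. exact: raddfB. Qed.

Lemma value0D Q Q' : value0 (Q + Q') = value0 Q + value0 Q'.
Proof. exact: raddfD. Qed.

Lemma value0M Q Q' : value0 (Q * Q') = value0 Q * value0 Q'.
Proof. exact: rmorphM. Qed.

Lemma value01 : value0 1 = 1.
Proof. exact: (rmorph1 (map_mpoly (evC 0))). Qed.

Lemma value0_sum (I : Type) (r : seq I) (G : I -> fpoly R N) :
  value0 (\sum_(i <- r) G i) = \sum_(i <- r) value0 (G i).
Proof. exact: raddf_sum. Qed.

Lemma value0Z (f : F) Q : value0 (f *: Q) = f 0 *: value0 Q.
Proof.
by apply/mpolyP => d; rewrite mcoeffZ !mcoeff_value0 mcoeffZ.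
Qed.

Lemma value0_var i : value0 (fvar R i) = var i.
Proof.
apply/mpolyP => d; rewrite mcoeff_value0 !mcoeffX.
by rewrite -[LHS]/(evC 0 _) rmorph_nat.
Qed.

Lemma value0_mderiv i Q : value0 (dfvar i Q) = mderiv i (value0 Q).
Proof.
apply/mpolyP => d; rewrite mcoeff_mderiv !mcoeff_value0 mcoeff_mderiv.
by rewrite -[LHS]/(evC 0 _) rmorphMn.
Qed.

Definition vertical0 (i j : 'I_N) P : mpoly M R :=
  var (Y_idx j) * mderiv (Y_idx i) P - var (xi_idx i) * mderiv (xi_idx j) P
  - var (eta_idx i) * mderiv (eta_idx j) P.

Lemma value0_vertical i j Q : value0 (vertical i j Q) = vertical0 i j (value0 Q).
Proof.
have key (a b c p q r : fpoly R N) : value0 (a * p - b * q - c * r) =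
    value0 a * value0 p - value0 b * value0 q - value0 c * value0 r.
  by rewrite !value0B !value0M.
apply: etrans (key _ _ _ _ _ _) _.
by congr (_ * _ - _ * _ - _ * _); [exact: value0_var|exact: value0_mderiv
  |exact: value0_var|exact: value0_mderiv|exact: value0_var|exact: value0_mderiv].
Qed.

(** A field that vanishes at the origin does not differentiate coefficients there, so its action
    descends to values at the origin. *)
Lemma value0_lie nu (As : 'M[R]_(n + n)) c Q (A := ac_mx As 0 c) :
  As *m J + J *m As^T = c *: J ->
  value0 (lie nu (field_of A (row_mx 0 0)) Q) =
  \sum_i \sum_j A j i *: vertical0 i j (value0 Q) + (nu * (n.+1%:R * c)) *: value0 Q.
Proof.
move=> AJ; set X := field_of A _.
have XE : affine_by X A (row_mx 0 0) by [].
have X0 i : X i 0 = 0 by rewrite ((affine_byP _ _ _).1 XE) mul0mx row_mx0 addr0 mxE.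
rewrite lieE (ac_divergence XE AJ) (lie_tensor_affine _ XE) !value0D value0Z -rmorphM.
congr (_ + _); rewrite !value0_sum big1 ?add0r => [|i _]; last first.
  by rewrite value0Z X0 scale0r.
apply: eq_bigr => i _; rewrite value0_sum; apply: eq_bigr => j _.
by rewrite value0Z value0_vertical.
Qed.

(** The dilation scales p and q with exponent 1 and t with exponent 2; its conformal factor is 2 and
    its divergence 2 (n + 1). This is the weight for which the monomial [d] has eigenvalue 0. *)
Definition dilation_weight d : R :=
  - (\sum_i (ac_mx 1%:M 0 2 i i) *
      ((d (Y_idx i))%:R - (d (xi_idx i))%:R - (d (eta_idx i))%:R)) / (n.+1%:R * 2).

Lemma invariant_weight S nu d : AC_invariant S ->
  mcoeff d (value0 (gcoef nu S)) != 0 -> nu = dilation_weight d.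
Proof.
move=> /AC_invariantP inv nz.
have AJ : 1%:M *m J + J *m 1%:M^T = 2 *: J.
  by rewrite mul1mx trmx1 mulmx1 scaler_nat.
have := congr1 value0 (inv _ _ (field_of_ac 0 0 AJ) nu).
rewrite (value0_lie _ _ AJ) => /(congr1 (mcoeff d)).
have -> : value0 0 = 0 by exact: raddf0.
set Q := value0 _ in nz *.
set A := ac_mx 1%:M 0 2.
pose k i : R := (d (Y_idx i))%:R - (d (xi_idx i))%:R - (d (eta_idx i))%:R.
have A_diag i j : j != i -> A j i = 0.
  case: (split_ordP i) => a ->; case: (split_ordP j) => b -> ji.
  - by rewrite block_mxEul mxE -(inj_eq (@lshift_inj _ 1)) (negPf ji).
  - by rewrite block_mxEdl mxE.
  - by rewrite block_mxEur mul0mx !mxE.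
  - by rewrite (ord1 a) (ord1 b) eqxx in ji.
have E : mcoeff d (\sum_i \sum_j A j i *: vertical0 i j Q) =
    (\sum_i A i i * k i) * mcoeff d Q.
  rewrite raddf_sum mulr_suml; apply: eq_bigr => i _ /=.
  rewrite (bigD1 i) //= big1 => [|j ji]; last by rewrite A_diag // scale0r.
  rewrite addr0 mcoeffZ /vertical0 !mcoeffB !mcoeff_euler -mulrA; congr (_ * _).
  by rewrite -!(mulr_natl (mcoeff d Q)) -!mulrBl.
rewrite mcoeffD E mcoeffZ mcoeff0 -mulrDl => /eqP.
rewrite mulf_eq0 (negPf nz) orbF addrC addr_eq0 => /eqP kE.
rewrite /dilation_weight -/A -kE mulfK // mulf_neq0 //.
all: by rewrite Num.Theory.pnatr_eq0.
Qed.

Lemma invariant_sp S nu : AC_invariant S -> sp_invariant (value0 (gcoef nu S)).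
Proof.
move=> /AC_invariantP inv a b; set Q := gcoef nu S.
(* The products of symmetric matrices with [J] make up sp(2n); c is 0 for them, which removes the
   weight. *)
pose As : 'M[R]_(n + n) := (delta_mx a b + delta_mx b a) *m J.
have AJ : As *m J + J *m As^T = 0 *: J.
  rewrite /As trmx_mul tr_sympJ raddfD /= !trmx_delta mulNmx mulmxN !mulmxA.
  rewrite -[_ *m J *m J]mulmxA sympJ_sqr mulmxN mulmx1 mulNmx mul1mx opprK scale0r.
  by rewrite [delta_mx b a + _]addrC addNr.
have := congr1 value0 (inv _ _ (field_of_ac 0 0 AJ) nu).
rewrite (value0_lie _ _ AJ) !mulr0 scale0r addr0.
have -> : value0 0 = 0 by exact: raddf0.
move=> <-; rewrite -/Q sum_phase [X in _ = _ + X]big1 ?addr0 => [|j _]; last first.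
  case: (split_ordP j) => k ->; last by rewrite block_mxEdr mxE mul0rn scale0r.
  by rewrite block_mxEur mul0mx !mxE scale0r.
rewrite -big_split; apply: eq_bigr => i _ /=; rewrite sum_phase block_mxEdl.
rewrite [const_mx _ _ _]mxE scale0r addr0.
have deltaJ k l j : (delta_mx k l *m J) j i = (j == k)%:R * J l i.
  rewrite mxE (bigD1 l) //= mxE eqxx andbT big1 ?addr0 // => p pl.
  by rewrite mxE (negPf pl) andbF mul0r.
under eq_bigr => j _ do rewrite block_mxEul /As mulmxDl mxE !deltaJ scalerDl.
rewrite big_split /=; congr (_ + _).
  rewrite (bigD1 a) //= eqxx mul1r big1 ?addr0 // => j ja.
  by rewrite (negPf ja) mul0r scale0r.
rewrite (bigD1 b) //= eqxx mul1r big1 ?addr0 // => j jb.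
by rewrite (negPf jb) mul0r scale0r.
Qed.

End ValueAtOrigin.

(** * Summation over the weights and lifts of the sp(2n)-generators *)

Section Generation.
Variables (R : realType) (n : nat).
Local Notation N := (n + n + 1)%N.
Local Notation M := (N + N + N)%N.
Local Notation s_ := (@lshift (n + n) 1).
Implicit Types (S T : symb R N).

(** The augmentation of the group algebra, composed with evaluation at the origin. *)
Definition symb_value0 S : mpoly M R := \sum_(nu <- gsupp S) value0 (gcoef nu S).

Lemma symb_value0w (D : {fset R}) S : (gsupp S `<=` D)%fset ->
  symb_value0 S = \sum_(nu <- D) value0 (gcoef nu S).
Proof.
move=> le; rewrite /symb_value0 (big_fset_incl _ le) // => nu _ /gcoef_out ->.
exact: raddf0.
Qed.

Lemma symb_value0_gmono nu Q : symb_value0 (gmono nu Q) = value0 Q.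
Proof.
have le : (gsupp (gmono nu Q : symb R N) `<=` [fset nu])%fset.
  by rewrite unlock; exact: monalg.msuppU_le.
by rewrite (symb_value0w le) big_seq_fset1 gcoef_mono eqxx.
Qed.

Fact symb_value0_zmod : zmod_morphism symb_value0.
Proof.
move=> S T; pose D := (gsupp S `|` gsupp T `|` gsupp (S - T)%R)%fset.
rewrite (@symb_value0w D S) ?(@symb_value0w D T) ?(@symb_value0w D (S - T)).
- rewrite -sumrB; apply: eq_bigr => nu _.
  by rewrite (raddfB (gcoef nu)) value0B.
- exact: fsubsetUr.
- by rewrite /D (fsetUC (gsupp S)) -fsetUA; exact: fsubsetUl.
- by rewrite /D -fsetUA; exact: fsubsetUl.
Qed.
HB.instance Definition _ :=
  GRing.isZmodMorphism.Build (symb R N) (mpoly M R) symb_value0 symb_value0_zmod.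

Fact symb_value0_monoid : monoid_morphism symb_value0.
Proof.
split; first by rewrite [LHS]symb_value0_gmono value01.
move=> S T; have MM nu Q mu Q' : symb_value0 (gmono nu Q * gmono mu Q') =
    symb_value0 (gmono nu Q) * symb_value0 (gmono mu Q').
  rewrite !symb_value0_gmono -value0M.
  have -> : gmono nu Q * gmono mu Q' = gmono (nu + mu) (Q * Q') :> symb R N.
    exact: gmul_mono.
  exact: symb_value0_gmono.
have MS nu Q : symb_value0 (gmono nu Q * T) = symb_value0 (gmono nu Q) * symb_value0 T.
  rewrite [T]galgE [in LHS]mulr_sumr [LHS]raddf_sum (raddf_sum symb_value0).
  by rewrite mulr_sumr; apply: eq_bigr => h _; exact: MM.
rewrite [S]galgE [in LHS]mulr_suml [LHS]raddf_sum (raddf_sum symb_value0).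
by rewrite mulr_suml; apply: eq_bigr => h _; exact: MS.
Qed.
HB.instance Definition _ :=
  GRing.isMonoidMorphism.Build (symb R N) (mpoly M R) symb_value0 symb_value0_monoid.

Lemma symb_value0_inj T : AC_invariant T -> symb_value0 T = 0 -> T = 0.
Proof.
move=> inv T0; apply/galgP => nu; rewrite raddf0.
apply: (invariant_eq0 (nu := nu)) => [X c Xc|d].
  exact: ((AC_invariantP T).1 inv X c).
rewrite -mcoeff_value0; apply/eqP; apply: contraT => nz.
have nuE := invariant_weight inv nz.
have := congr1 (mcoeff d) T0; rewrite mcoeff0 /symb_value0 raddf_sum /=.
have nuT : nu \in gsupp T.
  by apply: contraT => /gcoef_out T_nu; rewrite T_nu mcoeff_value0 mcoeff0 eqxx in nz.
rewrite (big_fsetD1 nu) //= big_seq big1 ?addr0 => [|mu]; first by move/eqP; rewrite (negPf nz).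
rewrite !inE => /andP[mu_nu _]; apply/eqP; apply: contraNT mu_nu => nz'.
by rewrite nuE (invariant_weight inv nz').
Qed.

Lemma sp_invariant0 : sp_invariant (0 : mpoly M R).
Proof.
move=> a b; rewrite /sp_op !big1 ?addr0 // => i _;
  by rewrite !raddf0 !mulr0 !subr0 scaler0.
Qed.

Lemma sp_invariantD (P Q : mpoly M R) :
  sp_invariant P -> sp_invariant Q -> sp_invariant (P + Q).
Proof.
have opD a b : sp_op a b (P + Q) = sp_op a b P + sp_op a b Q.
  rewrite /sp_op -big_split; apply: eq_bigr => i _ /=.
  by rewrite -scalerDr !mderivD; congr (_ *: _); ring.
by move=> Pinv Qinv a b; rewrite !opD addrACA Pinv Qinv addr0.
Qed.

Lemma symb_value0_sp S : AC_invariant S -> sp_invariant (symb_value0 S).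
Proof.
move=> inv; rewrite /symb_value0; apply: big_ind => [|P Q|nu _].
- exact: sp_invariant0.
- exact: sp_invariantD.
- exact: invariant_sp.
Qed.

(** At the origin [u1] also contains Y_t xi_t, which is the value of the product [u3 u4], of weight
    0 like [u1]; similarly for [u2]. The constants undo the factors -2 and - 1/2 in [u4], [u5] and
    alpha. *)
Definition lift_gen (i : 'I_6) : symb R N := nth 0
  [:: L1 R n; u1 R n - u3 R n * u4 R n; u2 R n - u3 R n * u5 R n;
      (- 2^-1) *: u4 R n; (- 2^-1) *: u5 R n; (- 2) *: u3 R n] i.

Lemma symb_value0Z a S : symb_value0 (a *: S) = a *: symb_value0 S.
Proof.
rewrite -[a *: S]/(symbC N a * S) rmorphM /= symb_value0_gmono value0Z.
by rewrite value01 -scalerAl mul1r.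
Qed.

Lemma value0_alpha : value0 (alpha R n) = - 2^-1 *: var (Y_idx (it n)).
Proof.
rewrite alphaE value0_sum sum_phase big1 ?add0r => [|i _]; last first.
  by rewrite value0Z alphacE mul0mx sub0r mxE row_mxEl mxE oppr0 mulr0 scale0r.
rewrite value0Z value0_var alphacE mul0mx sub0r mxE row_mxEr mxE eqxx.
by rewrite mulrN mulr1.
Qed.

Lemma value0_euler (zeta : 'I_N -> fpoly R N) : value0 (euler zeta) = 0.
Proof.
rewrite /euler value0_sum big1 // => k _.
by rewrite value0D !value0Z /= !mxE !scale0r addr0.
Qed.

Lemma value0_m2 (Q : fpoly R N) : value0 (- 2 * Q) = - 2 *: value0 Q.
Proof. by rewrite mulNr mulr_natl scaleNr scaler_nat -raddfMn; exact: raddfN. Qed.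

Lemma symb_value0_gen i : symb_value0 (lift_gen i) = sp_gen R n i.
Proof.
have half : (2^-1 * 2 : R) = 1 by rewrite mulVf // Num.Theory.pnatr_eq0.
have u34 zeta j : value0 (zeta (it n)) = var j ->
    symb_value0 (u3 R n * gmono (wI R n) (- 2 * zeta (it n)))
    = var (Y_idx (it n)) * var j.
  move=> zj; rewrite rmorphM /= !symb_value0_gmono value0_alpha value0_m2 zj.
  by rewrite -scalerAl -scalerAr scalerA mulrN mulNr opprK half scale1r.
have pairing zeta (z : 'I_N -> 'I_M) : (forall i, value0 (zeta i) = var (z i)) ->
    symb_value0 (gmono 0 (\sum_i Defs.Y R i * zeta i))
    - symb_value0 (u3 R n * gmono (wI R n) (- 2 * zeta (it n))) =
    \sum_i var (z (s_ i)) * var (Y_idx (s_ i)).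
  move=> zE; rewrite (u34 _ _ (zE _)) symb_value0_gmono value0_sum sum_phase.
  rewrite value0M value0_var zE addrK; apply: eq_bigr => j _.
  by rewrite value0M value0_var zE mulrC.
case: i => [[|[|[|[|[|[|//]]]]]] lt6]; rewrite /lift_gen /sp_gen /=.
- have key (p a e b e' : fpoly R N) : value0 e = 0 -> value0 e' = 0 ->
      value0 (p + a * e - b * e') = value0 p.
    by rewrite value0B value0D !value0M => -> ->; rewrite !mulr0 addr0 subr0.
  rewrite symb_value0_gmono (key _ _ _ _ _ (value0_euler _) (value0_euler _)).
  rewrite value0_sum; apply: eq_bigr => k _.
  by rewrite value0B !value0M !value0_var.
- by rewrite raddfB; apply: pairing => j; exact: value0_var.
- by rewrite raddfB; apply: pairing => j; exact: value0_var.
- rewrite symb_value0Z symb_value0_gmono value0_m2 value0_var scalerA.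
  by rewrite mulrN mulNr opprK half scale1r.
- rewrite symb_value0Z symb_value0_gmono value0_m2 value0_var scalerA.
  by rewrite mulrN mulNr opprK half scale1r.
- rewrite symb_value0Z symb_value0_gmono value0_alpha scalerA.
  by rewrite mulrN mulNr opprK mulrC half scale1r.
Qed.

End Generation.

Local Open Scope classical_set_scope.

Theorem theorem2 (R : realType) (n : nat) (hn : (0 < n)%N) :
  [set S : symb R (n + n + 1) | AC_invariant S] =
  gen_subalg [set u1 R n; u2 R n; u3 R n; u4 R n; u5 R n; L1 R n].
Proof.
set B := [set u1 R n; _; _; _; _; _].
have gen_inv : B `<=` [set S | AC_invariant S].
  move=> _ [[[[[->|->]|->]|->]|->]|->] /=; 
  [exact: AC_invariant_u1|exact: AC_invariant_u2|exact: AC_invariant_u3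
  |exact: AC_invariant_u4|exact: AC_invariant_u5|exact: AC_invariant_L1].
(* Stated for every subalgebra [C] containing [B]: it is used both for those defining the generated
   subalgebra and for the invariants themselves. *)
have inv_alg (f := GRing.in_alg (symb R (n + n + 1))) (C : set (symb R (n + n + 1))) G :
    GRing.subalg_closed [pred x | x \in C] -> B `<=` C -> C (mmap f (@lift_gen R n) G).
  move=> [/set_mem C1 Clin CM] BC.
  have CMs S T : C S -> C T -> C (S * T).
    by move=> /mem_set CS /mem_set CT; apply/set_mem/CM.
  have CZD (a : R) S T : C S -> C T -> C (a *: S + T).
    by move=> /mem_set CS /mem_set CT; apply/set_mem/Clin.
  have C0 : C 0 by rewrite -(addNr 1) -scaleN1r; exact: CZD.
  have CZ (a : R) S : C S -> C (a *: S) by move=> CS; rewrite -[_ *: _]addr0; exact: CZD.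
  have CD S T : C S -> C T -> C (S + T) by move=> ? ?; rewrite -[S]scale1r; exact: CZD.
  have CN S : C S -> C (- S) by move=> ?; rewrite -scaleN1r; exact: CZ.
  have BuC S : B S -> C S by exact: BC.
  elim/mpoly_ring_ind: G => [c|i|p q|p q].
  - by rewrite mmapC /f /=; exact: CZ.
  - rewrite mmap_var; case: i => [[|[|[|[|[|[|//]]]]]] lt6]; rewrite /lift_gen /=.
    + by apply: BuC; right.
    + by apply: (CD); [|apply: CN; apply: CMs]; apply: BuC; rewrite /B /=; tauto.
    + by apply: (CD); [|apply: CN; apply: CMs]; apply: BuC; rewrite /B /=; tauto.
    + by apply: CZ; apply: BuC; rewrite /B /=; tauto.
    + by apply: CZ; apply: BuC; rewrite /B /=; tauto.
    + by apply: CZ; apply: BuC; rewrite /B /=; tauto.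
  - by rewrite mmapD; exact: CD.
  - by rewrite rmorphM; exact: CMs.
have inv_closed : GRing.subalg_closed [pred x | x \in [set S | @AC_invariant R n S]].
  split.
  - apply/mem_set => /=; rewrite -(symbC1 R (n + n + 1)); exact: AC_invariantC.
  - move=> a S T /set_mem /= SI /set_mem /= TI; apply/mem_set => /=.
    by apply: AC_invariantD => //; exact: AC_invariantZ.
  - by move=> S T /set_mem /= SI /set_mem /= TI; apply/mem_set; exact: AC_invariantM.
apply/seteqP; split => S.
  move=> /= inv C /= [CC BC].
  have [G PG] := sp_first_fundamental_theorem (Ordinal hn) (symb_value0_sp inv).
  suff -> : S = mmap (GRing.in_alg (symb R (n + n + 1))) (@lift_gen R n) G by exact: inv_alg.
  (* Both sides are invariants with the same value at the origin, so their difference is 0. *)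
  apply/eqP; rewrite -subr_eq0; apply/eqP; apply: symb_value0_inj.
    rewrite -scaleN1r; apply: AC_invariantD => //; apply: AC_invariantZ.
    exact: (inv_alg [set S | AC_invariant S]).
  rewrite raddfB /= PG rmorph_mmap; apply/eqP; rewrite subr_eq0; apply/eqP.
  apply: eq_mmap => [c|i] /=; last by rewrite symb_value0_gen.
  by rewrite symb_value0Z rmorph1 -mul_mpolyC mulr1.
by apply: smallest_sub.
Qed.
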